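(* Let $f:\mathbb{R}^m\times\mathbb{R}^n\to\mathbb{R}$ be $\ell$-smooth, let $\mathcal{X}\subset\mathbb{R}^m$ and $\mathcal{Y}\subset\mathbb{R}^n$ be nonempty, closed, convex and bounded, and assume that $f(\cdot,y)$ is convex for each $y\in\mathcal{Y}$ and $f(x,\cdot)$ is concave for each $x\in\mathcal{X}$. Let $x_0\in\mathcal{X}$, $y_0\in\mathcal{Y}$, $\epsilon>0$, and define $$f_\epsilon(x,y)=f(x,y)+\frac{\epsilon}{8D_x^2}\|x-x_0\|^2-\frac{\epsilon}{8D_y^2}\|y-y_0\|^2 .$$ Then there exists $T>0$ such that the output $(\hat x,\hat y)=\text{Minimax-APPA}(f_\epsilon,x_0,y_0,\ell,\epsilon/(4D_x^2),\epsilon/(4D_y^2),\epsilon/2,T)$ is an $\epsilon$-saddle point of $f$, and the total number of gradient evaluations is bounded by $$O\left(\frac{\ell D_xD_y}{\epsilon}\,\log^3\left(\frac{\ell(D_x^2+D_y^2)}{\epsilon}\right)\right).$$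
   Context: Notation. $\|\cdot\|$ is the Euclidean norm; $\mathcal{P}_{\mathcal{Z}}$ is the Euclidean projection onto a closed convex set $\mathcal{Z}$; $D_x=\max_{x,x'\in\mathcal{X}}\|x-x'\|$ and $D_y=\max_{y,y'\in\mathcal{Y}}\|y-y'\|$, with $D_x,D_y>0$. $O(\cdot)$ hides only absolute constants that do not depend on any problem parameter. A function $h$ is $\ell$-smooth if $\|\nabla h(z)-\nabla h(z')\|\le \ell\|z-z'\|$ for all $z,z'$ (for $f$, with respect to the joint variable $(x,y)$). A point $(\hat x,\hat y)\in\mathcal{X}\times\mathcal{Y}$ is an $\epsilon$-saddle point of $f$ if $\max_{y\in\mathcal{Y}}f(\hat x,y)-\min_{x\in\mathcal{X}}f(x,\hat y)\le\epsilon$. Gradient evaluations are counted over the whole run, including all inner procedures. Procedure $\mathrm{AGD}(h,\mathcal{Z},z_0,L,m,\tau)$. Set $\tilde z_0=z_0$, $\kappa=L/m$, $\eta=1/L$, $\theta=\frac{\sqrt\kappa-1}{\sqrt\kappa+1}$. For $t=1,2,\dots$: $z_t=\mathcal{P}_{\mathcal{Z}}[\tilde z_{t-1}-\eta\nabla h(\tilde z_{t-1})]$, $\tilde z_t=z_t+\theta(z_t-z_{t-1})$. Stop at the first $t\ge1$ with $\|z_t-\mathcal{P}_{\mathcal{Z}}(z_t-\eta\nabla h(z_t))\|^2\le\frac{\tau}{2\kappa^2(L-m)}$ (right side read as $+\infty$ if $L=m$) and output $\mathcal{P}_{\mathcal{Z}}(z_t-\eta\nabla h(z_t))$. Procedure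 $\text{Maximin-AG2}(g,x_0,y_0,L,m_1,m_2,\tau)$. Set $\tilde y_0=y_0$, $k_1=L/m_1$, $k_2=L/m_2$, $\eta=\frac{1}{2k_1L}$, $\theta=\frac{4\sqrt{k_1k_2}-1}{4\sqrt{k_1k_2}+1}$, $\tilde\tau=\frac{\tau}{(10k_1k_2)^7}$. For $t=1,2,\dots$: $\tilde x_{t-1}=\mathrm{AGD}(g(\cdot,\tilde y_{t-1}),\mathcal{X},x_0,L,m_1,\tilde\tau)$; $y_t=\mathcal{P}_{\mathcal{Y}}[\tilde y_{t-1}+\eta\nabla_yg(\tilde x_{t-1},\tilde y_{t-1})]$; $\tilde y_t=y_t+\theta(y_t-y_{t-1})$; $x_t=\mathrm{AGD}(g(\cdot,y_t),\mathcal{X},x_0,L,m_1,\tilde\tau)$. Stop at the first $t\ge1$ with $\|y_t-\mathcal{P}_{\mathcal{Y}}(y_t+\eta\nabla_yg(x_t,y_t))\|^2\le\frac{\tau}{(10k_1k_2)^4L}$ and output $\mathcal{P}_{\mathcal{X}}(x_t-\frac{1}{2k_2L}\nabla_xg(x_t,y_t))$. Procedure $\text{Minimax-APPA}(F,x_0,y_0,\ell,\mu_1,\mu_2,\varepsilon,T)$. Set $\tilde x_0=x_0$, $\kappa_1=\ell/\mu_1$, $\kappa_2=\ell/\mu_2$, $\theta=\frac{2\sqrt{\kappa_1}-1}{2\sqrt{\kappa_1}+1}$, $\delta=\frac{\varepsilon}{(10\kappa_1\kappa_2)^4}$, $\tilde\varepsilon=\frac{\varepsilon}{10^2\kappa_1\kappa_2}$.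 For $t=1,\dots,T$: with $g_t(x,y)=F(x,y)+\ell\|x-\tilde x_{t-1}\|^2$, set $x_t=\text{Maximin-AG2}(g_t,x_0,y_0,3\ell,2\ell,\mu_2,\delta)$ and $\tilde x_t=x_t+\theta(x_t-x_{t-1})$. Then set $\tilde y=\mathrm{AGD}(-F(x_T,\cdot),\mathcal{Y},y_0,\ell,\mu_2,\tilde\varepsilon)$ and $y_T=\mathcal{P}_{\mathcal{Y}}(\tilde y+\frac{1}{2\kappa_1\ell}\nabla_yF(x_T,\tilde y))$, and output $(x_T,y_T)$.
   Formalization: Proved for ε ≤ cℓD_x² and ε ≤ cℓD_y² with an absolute constant c>0; without such a bound the claim fails: at ε = ℓ(D_x²+D_y²) the logarithm is 0, and for ε > 4ℓD_y² the last AGD call never stops. *)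

(* Defs.v *)
From HB Require Import structures.
From mathcomp Require Import all_boot all_order all_algebra.
From mathcomp Require Import all_classical all_reals all_analysis.
Set Implicit Arguments.
Unset Strict Implicit.
Unset Printing Implicit Defensive.
Import Order.TTheory GRing.Theory Num.Theory.
Import numFieldNormedType.Exports.
Local Open Scope classical_set_scope.
Local Open Scope ring_scope.

(* The library norm `|x| on 'rV[R]_n is the sup norm. *)
Definition enorm (R : realType) (n : nat) (x : 'rV[R]_n) : R :=
  Num.sqrt (\sum_(i < n) x 0 i ^+ 2).

Definition grad (R : realType) (n : nat) (h : 'rV[R]_n -> R) (x : 'rV[R]_n) :
  'rV[R]_n :=
  \row_(i < n) 'D_(delta_mx 0 i) h x.

Definition smooth (R : realType) (n : nat) (l : R) (h : 'rV[R]_n -> R) : Prop :=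
  (forall z, differentiable h z) /\
  (forall z z', enorm (grad h z - grad h z') <= l * enorm (z - z')).

(* f as a function of the joint variable z = row_mx x y. *)
Definition joint (R : realType) (m n : nat) (f : 'rV[R]_m -> 'rV[R]_n -> R)
    (z : 'rV[R]_(m + n)) : R :=
  f (lsubmx z) (rsubmx z).

(* The point of Z nearest to x; it exists and is unique when Z is nonempty,
   closed and convex, and the default value 0 of xget is then irrelevant. *)
Definition proj (R : realType) (n : nat) (Z : set 'rV[R]_n) (x : 'rV[R]_n) :
  'rV[R]_n :=
  xget 0 [set p | Z p /\ forall q, Z q -> enorm (x - p) <= enorm (x - q)].

Definition is_max (R : realType) (S : set R) (v : R) : Prop := S v /\ ubound S v.
Definition is_min (R : realType) (S : set R) (v : R) : Prop := S v /\ lbound S v.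

Definition is_diam (R : realType) (n : nat) (Z : set 'rV[R]_n) (D : R) : Prop :=
  is_max [set d | exists z z', [/\ Z z, Z z' & d = enorm (z - z')]] D.

Definition saddle (R : realType) (m n : nat) (X : set 'rV[R]_m)
    (Y : set 'rV[R]_n) (f : 'rV[R]_m -> 'rV[R]_n -> R) (eps : R)
    (xh : 'rV[R]_m) (yh : 'rV[R]_n) : Prop :=
  [/\ X xh, Y yh &
   exists M mu, [/\ is_max [set f xh y | y in Y] M,
                    is_min [set f x yh | x in X] mu & M - mu <= eps]].

(* The three procedures are deterministic but need not terminate, so each is
   given as a relation between its arguments, its output and its number of
   gradient evaluations. *)

(* First index t >= 1 at which a stopping test holds. *)
Definition first_stop (stop : nat -> Prop) (t : nat) : Prop :=
  [/\ (1 <= t)%N, stop t & forall s, (1 <= s < t)%N -> ~ stop s].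

(* Each iteration evaluates grad h at zt t.-1 (step) and at z t (stopping
   test); the output reuses the latter. *)
Definition AGD (R : realType) (n : nat) (h : 'rV[R]_n -> R) (Z : set 'rV[R]_n)
    (z0 : 'rV[R]_n) (L m tau : R) (out : 'rV[R]_n) (N : nat) : Prop :=
  let kappa := L / m in
  let eta := L^-1 in
  let theta := (Num.sqrt kappa - 1) / (Num.sqrt kappa + 1) in
  let step (w : 'rV[R]_n) := proj Z (w - eta *: grad h w) in
  exists (z zt : nat -> 'rV[R]_n) (t : nat),
  [/\ z 0%N = z0,
      zt 0%N = z0,
      forall s, z s.+1 = step (zt s) /\
                zt s.+1 = z s.+1 + theta *: (z s.+1 - z s),
      first_stop (fun s =>
        L = m \/ enorm (z s - step (z s)) ^+ 2
                   <= tau / (2 * kappa ^+ 2 * (L - m))) t &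
      out = step (z t) /\ N = (2 * t)%N].

(* Besides the two AGD calls (costs a s and b s.+1), each iteration evaluates
   the y-gradient of g at (xt s, yt s) and at (x s.+1, y s.+1); the output needs
   one x-gradient. *)
Definition Maximin_AG2 (R : realType) (m n : nat) (X : set 'rV[R]_m)
    (Y : set 'rV[R]_n) (g : 'rV[R]_m -> 'rV[R]_n -> R)
    (x0 : 'rV[R]_m) (y0 : 'rV[R]_n) (L m1 m2 tau : R)
    (out : 'rV[R]_m) (N : nat) : Prop :=
  let k1 := L / m1 in
  let k2 := L / m2 in
  let eta := (2 * k1 * L)^-1 in
  let theta := (4 * Num.sqrt (k1 * k2) - 1) / (4 * Num.sqrt (k1 * k2) + 1) in
  let taut := tau / (10 * k1 * k2) ^+ 7 in
  exists (x xt : nat -> 'rV[R]_m) (y yt : nat -> 'rV[R]_n) (a b : nat -> nat)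
         (t : nat),
  [/\ y 0%N = y0 /\ yt 0%N = y0,
      forall s, (s < t)%N ->
        [/\ AGD (fun u => g u (yt s)) X x0 L m1 taut (xt s) (a s),
            y s.+1 = proj Y (yt s + eta *: grad (g (xt s)) (yt s)),
            yt s.+1 = y s.+1 + theta *: (y s.+1 - y s) &
            AGD (fun u => g u (y s.+1)) X x0 L m1 taut (x s.+1) (b s.+1)],
      first_stop (fun s =>
        enorm (y s - proj Y (y s + eta *: grad (g (x s)) (y s))) ^+ 2
          <= tau / ((10 * k1 * k2) ^+ 4 * L)) t,
      out = proj X (x t - (2 * k2 * L)^-1 *: grad (fun u => g u (y t)) (x t)) &
      N = (\sum_(s < t) (a s + b s.+1 + 2) + 1)%N].

(* c s is the cost of the s-th Maximin_AG2 call and d that of the final AGD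
   call; one more y-gradient of F gives yh. *)
Definition Minimax_APPA (R : realType) (m n : nat) (X : set 'rV[R]_m)
    (Y : set 'rV[R]_n) (F : 'rV[R]_m -> 'rV[R]_n -> R)
    (x0 : 'rV[R]_m) (y0 : 'rV[R]_n) (l mu1 mu2 eps : R) (T : nat)
    (xh : 'rV[R]_m) (yh : 'rV[R]_n) (N : nat) : Prop :=
  let kappa1 := l / mu1 in
  let kappa2 := l / mu2 in
  let theta := (2 * Num.sqrt kappa1 - 1) / (2 * Num.sqrt kappa1 + 1) in
  let delta := eps / (10 * kappa1 * kappa2) ^+ 4 in
  let epst := eps / (10 ^+ 2 * kappa1 * kappa2) in
  exists (x xt : nat -> 'rV[R]_m) (c : nat -> nat) (yt : 'rV[R]_n) (d : nat),
  [/\ x 0%N = x0 /\ xt 0%N = x0,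
      forall s, (s < T)%N ->
        Maximin_AG2 X Y (fun u v => F u v + l * enorm (u - xt s) ^+ 2)
          x0 y0 (3 * l) (2 * l) mu2 delta (x s.+1) (c s.+1) /\
        xt s.+1 = x s.+1 + theta *: (x s.+1 - x s),
      AGD (fun v => - F (x T) v) Y y0 l mu2 epst yt d,
      xh = x T /\
      yh = proj Y (yt + (2 * kappa1 * l)^-1 *: grad (F (x T)) yt) &
      N = (\sum_(s < T) c s.+1 + d + 1)%N].

Definition f_reg (R : realType) (m n : nat) (f : 'rV[R]_m -> 'rV[R]_n -> R)
    (eps Dx Dy : R) (x0 : 'rV[R]_m) (y0 : 'rV[R]_n)
    (x : 'rV[R]_m) (y : 'rV[R]_n) : R :=
  f x y + eps / (8 * Dx ^+ 2) * enorm (x - x0) ^+ 2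
        - eps / (8 * Dy ^+ 2) * enorm (y - y0) ^+ 2.

(* Main.v *)
Require Import Defs.
From mathcomp Require Import all_boot all_order all_algebra.
From mathcomp Require Import all_classical all_reals all_analysis.
From mathcomp Require Import ring lra.
Import Order.TTheory GRing.Theory Num.Theory.
Import numFieldNormedType.Exports.
Local Open Scope classical_set_scope.
Local Open Scope ring_scope.
Set Implicit Arguments.
Unset Strict Implicit.
Unset Printing Implicit Defensive.

(** The regularized function F = f_eps is strongly convex in x with modulus
    mu1 = eps / (4 Dx^2), strongly concave in y with modulus
    mu2 = eps / (4 Dy^2), and each regularizing term is at most eps / 8 on X and
    Y; so a pair whose duality gap for F is at most eps / 2 is an eps-saddle
    point of f (f_reg_gap_saddle).

    Such a pair is found by three nested loops, with k1 = l / mu1 and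
    k2 = l / mu2. The outer loop is the accelerated proximal point method for
    the primal function, the maximum of F x over Y, and takes of the order of
    sqrt k1 steps. Its step with center w minimizes the primal function of
    g = F + l |x - w|^2. The middle loop maximizes the dual function of g, the
    minimum over x of g x y, by accelerated gradient ascent; this function is
    smooth with constant of order l and strongly concave with modulus mu2, which
    gives sqrt k2 steps. By Danskin's theorem its gradient at y is the
    y-gradient of g at the minimizer of g (., y), a problem of constant condition
    number which the inner loop solves at a linear rate. As
    sqrt (k1 k2) = 4 l Dx Dy / eps, and as each loop multiplies the count by the
    logarithm of a ratio of accuracies polynomial in k1 + k2 (counts_exist), the
    announced bound follows.

    The accelerated loops have one analysis (accel_rate): a Lyapunov function
    contracts by 1 - 1 / (2 Q), where L = m Q^2, provided that each step satisfies
    the usual three-point inequality up to an additive error and up to a loss of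
    relative size 1 / Q^2 in its quadratic term. The additive error accounts for
    the inexact solution of the subproblems (sf_dual_ascent_step, prox_step). The
    relative loss is needed because the last call of the gradient method takes
    steps of length 1 / l although the gradient of F is Lipschitz only with
    constant l + mu2 (AGD_accelerated).

    Two features of the constrained setting shape the intermediate lemmas. The
    points extrapolated by the middle loop may leave Y, and there f (., y) need
    not be convex; but the term l |x - w|^2 outweighs the possible concavity, so
    the inner problem remains strongly convex and its value smooth
    (sf_step_contract, sf_dual_lower_weak). And the gradient of F at the solution
    is not bounded in terms of the parameters when a constraint is active, so that
    nearness of points does not bound a difference of values; a final projected
    gradient step does, since the variational inequality that it satisfies
    cancels the large part of the gradient (sf_saddle_step). For the same reason
    the rates are counted from the first iterate, at which the error in value is
    of order L D^2 whatever the gradient at the starting point. *)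

Local Notation proj := Defs.proj.

(** * Euclidean geometry *)

Definition dot (R : realType) (n : nat) (x y : 'rV[R]_n) : R :=
  \sum_(i < n) x 0 i * y 0 i.

Section dot_theory.
Context {R : realType} {n : nat}.
Implicit Types (x y z : 'rV[R]_n) (a b c : R).

Lemma dotC x y : dot x y = dot y x.
Proof. by apply: eq_bigr => i _; rewrite mulrC. Qed.

Lemma dotDl x y z : dot (x + y) z = dot x z + dot y z.
Proof. by rewrite -big_split /=; apply: eq_bigr => i _; rewrite mxE mulrDl. Qed.

Lemma dotZl a x y : dot (a *: x) y = a * dot x y.
Proof. by rewrite mulr_sumr; apply: eq_bigr => i _; rewrite mxE mulrA. Qed.

Lemma dotDr x y z : dot x (y + z) = dot x y + dot x z.
Proof. by rewrite !(dotC x) dotDl. Qed.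

Lemma dotZr a x y : dot x (a *: y) = a * dot x y.
Proof. by rewrite !(dotC x) dotZl. Qed.

Lemma dotNl x y : dot (- x) y = - dot x y.
Proof. by rewrite -scaleN1r dotZl mulN1r. Qed.

Lemma dotNr x y : dot x (- y) = - dot x y.
Proof. by rewrite !(dotC x) dotNl. Qed.

Lemma dot0l x : dot 0 x = 0.
Proof. by rewrite -(scale0r 0) dotZl mul0r. Qed.

Lemma dot0r x : dot x 0 = 0.
Proof. by rewrite dotC dot0l. Qed.

Definition dotE := (dotDl, dotDr, dotNl, dotNr, dotZl, dotZr, dot0l, dot0r).

Lemma dot_ge0 x : 0 <= dot x x.
Proof. by apply: sumr_ge0 => i _; rewrite -expr2 sqr_ge0. Qed.

Lemma dot_eq0 x : (dot x x == 0) = (x == 0).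
Proof.
apply/eqP/eqP => [x0|->]; last by rewrite dot0l.
apply/rowP => i; rewrite mxE; apply/eqP.
rewrite -sqrf_eq0 expr2 -(psumr_eq0P _ x0 (i := i)) // => j _.
by rewrite -expr2 sqr_ge0.
Qed.

Lemma enorm_ge0 x : 0 <= enorm x.
Proof. exact: sqrtr_ge0. Qed.

Lemma enorm_sqr x : enorm x ^+ 2 = dot x x.
Proof.
rewrite sqr_sqrtr; first by apply: eq_bigr => i _; rewrite expr2.
by apply: sumr_ge0 => i _; rewrite sqr_ge0.
Qed.

Lemma enormE x : enorm x = Num.sqrt (dot x x).
Proof. by rewrite -enorm_sqr sqrtr_sqr ger0_norm ?enorm_ge0. Qed.

Lemma enorm0 : enorm (0 : 'rV[R]_n) = 0.
Proof. by rewrite enormE dot0l sqrtr0. Qed.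

Lemma enormN x : enorm (- x) = enorm x.
Proof. by rewrite !enormE !dotE opprK. Qed.

Lemma enormB x y : enorm (x - y) = enorm (y - x).
Proof. by rewrite -opprB enormN. Qed.

Lemma enormZ a x : enorm (a *: x) = `|a| * enorm x.
Proof. by rewrite !enormE !dotE mulrA -expr2 sqrtrM ?sqr_ge0 // sqrtr_sqr. Qed.

Lemma ler_enorm x y : (enorm x <= enorm y) = (dot x x <= dot y y).
Proof. by rewrite -!enorm_sqr ler_pXn2r ?nnegrE ?enorm_ge0. Qed.

Lemma enorm_le_sqr x c : 0 <= c -> (enorm x <= c) = (dot x x <= c ^+ 2).
Proof. by move=> c0; rewrite -enorm_sqr ler_pXn2r ?nnegrE ?enorm_ge0. Qed.

Lemma dot_le_enorm x y : dot x y <= enorm x * enorm y.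
Proof.
have [->|x0] := eqVneq x 0; first by rewrite dot0l enorm0 mul0r.
have [->|y0] := eqVneq y 0; first by rewrite dot0r enorm0 mulr0.
have gt0 z : z != 0 -> 0 < enorm z.
  by move=> z0; rewrite enormE sqrtr_gt0 lt_neqAle dot_ge0 eq_sym dot_eq0 z0.
have := dot_ge0 (enorm y *: x - enorm x *: y).
rewrite !dotE (dotC y x) -(enorm_sqr x) -(enorm_sqr y).
have := gt0 _ x0; have := gt0 _ y0.
move: (enorm x) (enorm y) (dot x y) => a b c b0 a0 h.
by rewrite -(ler_pM2l (mulr_gt0 a0 b0)); nra.
Qed.

Lemma norm_dot_le x y : `|dot x y| <= enorm x * enorm y.
Proof. by rewrite ler_norml -(enormN x) lerNl -dotNl dot_le_enorm enormN dot_le_enorm. Qed.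

Lemma ler_enormD x y : enorm (x + y) <= enorm x + enorm y.
Proof.
rewrite enorm_le_sqr ?addr_ge0 ?enorm_ge0 // !dotE (dotC y x).
by have := dot_le_enorm x y; rewrite -(enorm_sqr x) -(enorm_sqr y); lra.
Qed.

Lemma ler_enormB x y : enorm (x - y) <= enorm x + enorm y.
Proof. by rewrite -(enormN y) ler_enormD. Qed.

Lemma ler_enorm_sub z x y : enorm (x - y) <= enorm (x - z) + enorm (z - y).
Proof. by rewrite -(subrKA z) ler_enormD. Qed.

Lemma ler_cancel_sqr a b c : 0 <= b -> 0 <= c -> a * c ^+ 2 <= b * c -> a * c <= b.
Proof.
move=> b0; rewrite le_eqVlt => /orP[/eqP<-|c0]; first by rewrite !mulr0.
by rewrite expr2 mulrA ler_pM2r.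
Qed.

(** Young's inequality, for trading a scalar product against squares. *)
Lemma dot_young a x y : 0 < a -> dot x y <= a / 2 * dot x x + (2 * a)^-1 * dot y y.
Proof.
move=> a0; have := dot_ge0 (a *: x - y); rewrite !dotE (dotC y x) => h.
rewrite -(ler_pM2l a0) mulrDr invfM mulrA.
have -> : a * ((2^-1 / a) * dot y y) = dot y y / 2.
  by rewrite mulrA mulrCA divff ?gt_eqF // mulr1 mulrC.
by rewrite !mulrA; nra.
Qed.

Lemma dot_coord_le x : dot x x <= n%:R * `|x| ^+ 2.
Proof.
rewrite -[n in n%:R]card_ord -sumr_const mulr_suml; apply: ler_sum => i _.
rewrite mul1r -expr2 -real_normK ?num_real // ler_pXn2r ?nnegrE ?normr_ge0 //.
rewrite [leRHS]/Num.norm /= mx_normrE; apply/bigmax_geP; right => /=.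
by exists (0, i).
Qed.

End dot_theory.

(** * First-order calculus with quadratic remainders *)

(** The quadratic expansion of a function whose gradient G is Lipschitz; as a
    relation between values of h it makes sense on any Z and passes to minima
    over a parameter, for which differentiability is not known beforehand. *)
Definition quad_grad (R : realType) (n : nat) (Z : set 'rV[R]_n)
    (h : 'rV[R]_n -> R) (G : 'rV[R]_n -> 'rV[R]_n) (K : R) : Prop :=
  forall z z', Z z -> Z z' ->
    `|h z' - h z - dot (G z) (z' - z)| <= K * dot (z' - z) (z' - z).

Definition segment_closed (R : realType) (n : nat) (Z : set 'rV[R]_n) : Prop :=
  forall x y t, Z x -> Z y -> 0 <= t -> t <= 1 -> Z (x + t *: (y - x)).

Definition body (R : realType) (n : nat) (Z : set 'rV[R]_n) : Prop :=
  [/\ Z !=set0, compact Z & segment_closed Z].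

Section quad_grad_theory.
Context {R : realType} {n : nat}.
Implicit Types (Z : set 'rV[R]_n) (h : 'rV[R]_n -> R) (G : 'rV[R]_n -> 'rV[R]_n).

(** The expansion determines the gradient, whence all gradients of the
    procedures are computed without differentiation rules. *)
Lemma quad_grad_grad h G K z : quad_grad setT h G K -> grad h z = G z.
Proof.
move=> hG; apply/rowP => i; rewrite mxE.
have -> : G z 0 i = dot (G z) (delta_mx 0 i).
  rewrite /dot (bigD1 i) //= big1 ?addr0 => [|j ji].
    by rewrite mxE !eqxx mulr1.
  by rewrite mxE (negbTE ji) andbF mulr0.
set v := delta_mx 0 i; apply: cvg_lim => //.
apply/cvgrPdist_le => e e0.
pose k := `|K| * dot v v + 1.
have k0 : 0 < k by rewrite ltr_wpDl // mulr_ge0 ?dot_ge0.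
near=> t.
have t0 : t != 0 by near: t; exact: nbhs_dnbhs_neq.
have te : `|t| <= e / k.
  near: t; apply: dnbhs0_le; exact: divr_gt0.
have := hG z (t *: v + z) I I; rewrite addrK !dotE.
have -> : (h \o shift z) (t *: v) = h (t *: v + z) by [].
set D := h _ - _ => hD.
have -> : dot (G z) v - t^-1 *: D = - (t^-1 * (D - t * dot (G z) v)).
  by rewrite mulrBr mulKf // opprB.
rewrite normrN normrM normfV ler_pdivrMl ?normr_gt0 //.
apply: (le_trans hD); apply: (@le_trans _ _ (`|t| * (`|t| * k))).
  have -> : K * (t * (t * dot v v)) = t ^+ 2 * (K * dot v v) by ring.
  have -> : `|t| * (`|t| * k) = t ^+ 2 * k by rewrite mulrA -expr2 real_normK ?num_real.
  rewrite ler_wpM2l ?sqr_ge0 // /k.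
  by have := ler_norm K; have := dot_ge0 v; nra.
by rewrite ler_wpM2l // -ler_pdivlMr.
Unshelve. all: by end_near.
Qed.

Lemma quad_grad_continuous Z h G K :
  quad_grad Z h G K -> {within Z, continuous h}.
Proof.
move=> hG; apply/subspace_continuousP => z Zz.
apply/cvgrPdist_le => e e0.
pose c := enorm (G z) + `|K| + 1.
have c0 : 0 < c.
  by rewrite ltr_wpDl // addr_ge0 ?enorm_ge0.
pose N := n%:R + 1 : R.
have N0 : 0 < N by rewrite /N ltr_wpDl.
pose r := Num.min 1 (e / c) / N.
have m0 : 0 < Num.min 1 (e / c) by rewrite lt_min ltr01 divr_gt0.
have r0 : 0 < r by rewrite divr_gt0.
rewrite near_withinE; near=> z' => Zz'.
have zz' : `|z' - z| <= r by near: z'; apply: cvgr_distC_le; [exact: cvg_id|].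
have en : enorm (z' - z) <= Num.min 1 (e / c).
  rewrite enorm_le_sqr ?(ltW m0) //; apply: (le_trans (dot_coord_le _)).
  apply: (@le_trans _ _ (n%:R * r ^+ 2)).
    by rewrite ler_wpM2l // ler_pXn2r ?nnegrE ?(ltW r0).
  rewrite /r expr_div_n mulrCA ger_pMr ?exprn_gt0 // ler_pdivrMr ?exprn_gt0 //.
  rewrite mul1r /N; have : 0 <= n%:R :> R by []. nra.
move: en; rewrite le_min => /andP[en1 en2].
have := hG _ _ Zz Zz'; have := norm_dot_le (G z) (z' - z).
rewrite -enorm_sqr (distrC (h z)); set E := enorm _ in en1 en2 *.
have E0 : 0 <= E by exact: enorm_ge0.
move=> h1 h2.
have : `|h z' - h z| <= E * c.
  rewrite -(subrK (dot (G z) (z' - z)) (h z' - h z)).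
  apply: (le_trans (ler_normD _ _)); apply: (le_trans (lerD h2 h1)).
  have : K * E ^+ 2 <= `|K| * E.
    rewrite expr2 mulrA ler_wpM2r //; apply: (le_trans (ler_norm _)).
    by rewrite normrM (ger0_norm E0) ler_piMr.
  by rewrite /c -/E; nra.
by move/le_trans; apply; rewrite -ler_pdivlMr.
Unshelve. all: by end_near.
Qed.

Lemma quad_grad_argmin Z h G K : body Z -> quad_grad Z h G K ->
  exists2 z, Z z & forall z', Z z' -> h z <= h z'.
Proof.
move=> [Z0 cZ _] hG.
have [z zZ zmin] := EVT_min_rV Z0 cZ (quad_grad_continuous hG).
by exists z => [|z' Zz']; [exact/set_mem | apply: zmin; exact/mem_set].
Qed.

(** Moving by a fraction t towards z' changes h by t times the linear term, up
    to order t^2, so the linear term is nonnegative. *)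
Lemma argmin_first_order Z h G K z : body Z -> quad_grad Z h G K ->
  Z z -> (forall z', Z z' -> h z <= h z') ->
  forall z', Z z' -> 0 <= dot (G z) (z' - z).
Proof.
move=> [_ _ segZ] hG Zz zmin z' Zz'.
rewrite leNgt; apply/negP => neg.
set g := dot _ _ in neg; set s := dot (z' - z) (z' - z).
have s0 : 0 <= s by exact: dot_ge0.
pose c := `|K| * s - g + 1.
have Ks0 : 0 <= `|K| * s by rewrite mulr_ge0.
have c0 : 0 < c by rewrite /c; lra.
(* small enough for the term linear in t to dominate *)
pose t := - g / c.
have t0 : 0 < t by rewrite divr_gt0 // oppr_gt0.
have t1 : t <= 1 by rewrite /t ler_pdivrMr // /c; lra.
have Zt := segZ _ _ _ Zz Zz' (ltW t0) t1.
have := hG _ _ Zz Zt; have := zmin _ Zt.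
rewrite [z + _ - z]addrAC subrr add0r !dotZl !dotZr -/g -/s => h1.
move/(le_trans (ler_norm _)) => h2.
have h3 : 0 <= t * (g + t * (K * s)) by lra.
rewrite pmulr_rge0 // in h3.
have : t * (K * s) <= t * (`|K| * s).
  by rewrite ler_wpM2l ?(ltW t0) // ler_wpM2r // ler_norm.
have : t * c = - g by rewrite /t divfK ?gt_eqF.
rewrite /c; nra.
Qed.

Lemma quad_grad_sqr Z w :
  quad_grad Z (fun z => dot (z - w) (z - w)) (fun z => 2 *: (z - w)) 1.
Proof.
move=> z z' _ _; rewrite mul1r le_eqVlt; apply/orP; left; apply/eqP.
rewrite -[RHS]ger0_norm ?dot_ge0 //; congr `|_|.
by rewrite !dotE (dotC w z') (dotC w z) (dotC z' z); ring.
Qed.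

End quad_grad_theory.

(** * Projection onto a convex body *)

Section projection.
Context {R : realType} {n : nat}.
Implicit Types (Z : set 'rV[R]_n) (x y p q : 'rV[R]_n).

(** The nearest point minimizes the squared distance to x, and this is its
    first-order condition. *)
Lemma proj_spec Z x : body Z ->
  Z (proj Z x) /\ forall q, Z q -> dot (x - proj Z x) (q - proj Z x) <= 0.
Proof.
move=> bZ.
have [p0 Zp0 p0min] := quad_grad_argmin bZ (quad_grad_sqr (Z:=Z) x).
have [Zp pmin] : Z (proj Z x) /\ forall q, Z q -> enorm (x - proj Z x) <= enorm (x - q).
  apply: (xgetPex 0 (P := [set p | Z p /\ forall q, Z q -> enorm (x - p) <= enorm (x - q)])).
  by exists p0; split=> // q Zq; rewrite !(enormB x) ler_enorm p0min.
split=> // q Zq.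
have pmin' q' : Z q' -> dot (proj Z x - x) (proj Z x - x) <= dot (q' - x) (q' - x).
  by move=> Zq'; rewrite -ler_enorm !(enormB _ x) pmin.
have := argmin_first_order bZ (quad_grad_sqr (Z:=Z) x) Zp pmin' Zq.
by rewrite dotZl -(opprB x) dotNl; lra.
Qed.

Lemma proj_in Z x : body Z -> Z (proj Z x).
Proof. by move=> bZ; case: (proj_spec x bZ). Qed.

Lemma proj_obtuse Z x q : body Z -> Z q ->
  dot (x - proj Z x) (q - proj Z x) <= 0.
Proof. by move=> bZ; case: (proj_spec x bZ) => _; apply. Qed.

Lemma proj_unique Z x p : body Z -> Z p ->
  (forall q, Z q -> dot (x - p) (q - p) <= 0) -> proj Z x = p.
Proof.
move=> bZ Zp hp; apply/eqP; rewrite -subr_eq0 -dot_eq0 eq_le dot_ge0 andbT.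
have := hp _ (proj_in x bZ); have := proj_obtuse x bZ Zp.
set p' := proj Z x.
by rewrite !dotE (dotC p' p) ; lra.
Qed.

Lemma proj_lipschitz Z x y : body Z ->
  enorm (proj Z x - proj Z y) <= enorm (x - y).
Proof.
move=> bZ; have := proj_obtuse x bZ (proj_in y bZ).
have := proj_obtuse y bZ (proj_in x bZ).
set p := proj Z x; set q := proj Z y => h1 h2.
have h : dot (p - q) (p - q) <= dot (x - y) (p - q).
  by move: h1 h2; rewrite !dotE (dotC q p); lra.
rewrite -[leLHS]mul1r; apply: ler_cancel_sqr; rewrite ?enorm_ge0 //.
by rewrite mul1r enorm_sqr (le_trans h) ?dot_le_enorm.
Qed.

End projection.

(** * Accelerated descent with a perturbed three-point inequality *)

Section acceleration.
Context {R : realType} {n : nat}.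

Lemma dotBB_le (x y : 'rV[R]_n) : dot (x - y) (x - y) <= 2 * (dot x x + dot y y).
Proof. by have := dot_ge0 (x + y); rewrite !dotE (dotC y x); lra. Qed.

(** The classical decrease of the Lyapunov function H + m / 2 |b|^2 needs
    A >= m Q^2. If A is smaller by m, an excess m / 2 |d|^2 remains. But d is a
    difference of two displacements, e from the previous iterate to the
    extrapolated point and e - d from the previous to the next iterate; both
    are of order 1 / Q times the distance between an iterate and its auxiliary
    point, which the Lyapunov functions control. So the excess is of relative
    order 1 / Q^2, less than half of the decrease 1 / Q. All vectors are relative
    to the minimizer: a, w, a' are the iterate, the extrapolated point and the
    next iterate, b and b' the auxiliary points. *)
Lemma accel_step (m Q A del H H' : R) (w e d : 'rV[R]_n) :
  let a := w - e in let b := w + Q *: e in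
  let a' := w - d in let b' := a + Q *: (a' - a) in
  0 < m -> 100 <= Q -> m * (Q ^+ 2 - 1) <= A -> 0 <= del ->
  m / 2 * dot a a <= H -> m / 2 * dot a' a' <= H' ->
  H' + A / 2 * dot d d - m * Q ^+ 2 * dot d e + m / 2 * dot e e - del <= H ->
  H' + A / 2 * dot d d - m * Q ^+ 2 * dot d w + m / 2 * dot w w - del <= 0 ->
  H' + m / 2 * dot b' b' <= (1 - (2 * Q)^-1) * (H + m / 2 * dot b b) + 2 * del.
Proof.
move=> a b a' b' m0 Q100 mA del0 haH haH' h1 h2.
set V := H + _; set V' := H' + _.
have Q0 : 0 < Q by lra.
have m2 : 0 < m / 2 by lra.
(* the classical combination with weights 1 - 1 / Q and 1 / Q *)
have key : Q * V' <= (Q - 1) * V + Q * (m / 2 * dot d d) + Q * del.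
  have hA : Q / 2 * (m * (Q ^+ 2 - 1)) * dot d d <= Q / 2 * A * dot d d.
    by rewrite ler_wpM2r ?dot_ge0 // ler_wpM2l //; lra.
  have he : 0 <= (Q ^+ 2 - 1) * (m / 2 * dot e e).
    by rewrite mulr_ge0 ?mulr_ge0 ?dot_ge0 ?(ltW m2) //; nra.
  have h1' := ler_wpM2l (_ : 0 <= Q - 1) h1; have {h1'} := h1' ltac:(lra).
  move: hA he h2; rewrite /V /V' /b' /b /a /a' !dotE (dotC e w) (dotC d w) (dotC d e).
  move: (dot w w) (dot w e) (dot e e) (dot w d) (dot e d) (dot d d).
  move=> ww we ee wd ed dd; lra.
have hV : m / 2 * dot b b <= V - m / 2 * dot a a by rewrite /V; lra.
have hV' : m / 2 * dot b' b' <= V' - m / 2 * dot a' a' by rewrite /V'; lra.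
have he : (Q + 1) ^+ 2 * (m / 2 * dot e e) <= 2 * V.
  have -> : (Q + 1) ^+ 2 * (m / 2 * dot e e) = m / 2 * dot (b - a) (b - a).
    by rewrite /a /b !dotE (dotC e w); ring.
  by have := ler_wpM2l (ltW m2) (dotBB_le b a); lra.
have hed : (Q - 1) ^+ 2 * (m / 2 * dot (e - d) (e - d)) <= 2 * V'.
  have -> : (Q - 1) ^+ 2 * (m / 2 * dot (e - d) (e - d)) = m / 2 * dot (b' - a') (b' - a').
    by rewrite /b' /a' /a !dotE (dotC e w) (dotC d w) (dotC d e); ring.
  by have := ler_wpM2l (ltW m2) (dotBB_le b' a'); lra.
have V0 : 0 <= V by have := dot_ge0 a; have := dot_ge0 b; rewrite /V; nra.
have V'0 : 0 <= V' by have := dot_ge0 a'; have := dot_ge0 b'; rewrite /V'; nra.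
have hd : m / 2 * dot d d <= 2 * (m / 2 * dot e e) + 2 * (m / 2 * dot (e - d) (e - d)).
  have := ler_wpM2l (ltW m2) (dotBB_le e (e - d)); rewrite opprB addrCA subrr addr0; lra.
have e0 : 0 <= m / 2 * dot e e by rewrite mulr_ge0 ?dot_ge0 ?ltW.
have ed0 : 0 <= m / 2 * dot (e - d) (e - d) by rewrite mulr_ge0 ?dot_ge0 ?ltW.
move: (m / 2 * dot e e) (m / 2 * dot (e - d) (e - d)) (m / 2 * dot d d) e0 ed0 hd he hed key.
move=> E F G E0 F0 hd he hed key.
have {}he : 50 * (Q * E) <= V by nra.
have {}hed : 49 * (Q * F) <= V' by nra.
have {}hd : Q * G <= V / 25 + 2 / 49 * V'.
  by have := ler_wpM2l (ltW Q0) hd; lra.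
have {}key : (Q - 2 / 49) * V' <= (Q - 24 / 25) * V + Q * del by lra.
rewrite -(ler_pM2l Q0).
have -> : Q * ((1 - (2 * Q)^-1) * V + 2 * del) = (Q - 2^-1) * V + Q * (2 * del).
  by field; lra.
rewrite -(ler_pM2l (_ : 0 < Q - 2 / 49)); last by lra.
have : Q * ((Q - 2 / 49) * V') <= Q * ((Q - 24 / 25) * V + Q * del).
  by rewrite ler_wpM2l // ltW.
have : Q * ((Q - 24 / 25) * V) <= (Q - 2 / 49) * ((Q - 2^-1) * V).
  by rewrite !mulrA ler_wpM2r //; nra.
have : Q * (Q * del) <= (Q - 2 / 49) * (Q * (2 * del)).
  have : 0 <= Q * del * (Q - 4 / 49) by rewrite !mulr_ge0 //; lra.
  by lra.
by lra.
Qed.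

(** The auxiliary point of index s is z s + Q (z s.+1 - z s). The first step
    alone brings the Lyapunov function down to the order of m Q^2 D^2, by the
    three-point inequality at zs. *)
Lemma accel_rate (Z : set 'rV[R]_n) (h : 'rV[R]_n -> R) (zs : 'rV[R]_n)
    (z w : nat -> 'rV[R]_n) (m Q A del D : R) :
  0 < m -> 100 <= Q -> m * (Q ^+ 2 - 1) <= A -> 0 <= del ->
  (forall x y, Z x -> Z y -> enorm (x - y) <= D) ->
  Z zs -> (forall s, Z (z s)) -> w 0%N = z 0%N ->
  (forall s, w s.+1 = z s.+1 + ((Q - 1) / (Q + 1)) *: (z s.+1 - z s)) ->
  (forall x, Z x -> h zs + m / 2 * dot (x - zs) (x - zs) <= h x) ->
  (forall s x, Z x ->
     h (z s.+1) + A / 2 * dot (w s - z s.+1) (w s - z s.+1)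
       + m * Q ^+ 2 * dot (w s - z s.+1) (x - w s)
       + m / 2 * dot (x - w s) (x - w s) - del <= h x) ->
  forall t, h (z t.+1) - h zs <=
    (1 - (2 * Q)^-1) ^+ t * (3 * (m * Q ^+ 2) * D ^+ 2 + del) + 4 * Q * del.
Proof.
move=> m0 Q100 mA del0 diam Zzs Zz w0 wS strong step t.
have Q0 : 0 < Q by lra.
pose b s := z s - zs + Q *: (z s.+1 - z s).
pose V s := h (z s.+1) - h zs + m / 2 * dot (b s) (b s).
have wE s : w s.+1 - zs + Q *: (w s.+1 - z s.+1) = b s.
  rewrite wS /b; apply/rowP => i; rewrite !mxE; field.
  by lra.
have VS s : V s.+1 <= (1 - (2 * Q)^-1) * V s + 2 * del.
  rewrite /V -(wE s).
  have := @accel_step m Q A del (h (z s.+1) - h zs) (h (z s.+2) - h zs)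
    (w s.+1 - zs) (w s.+1 - z s.+1) (w s.+1 - z s.+2) m0 Q100 mA del0.
  have E1 x y u : x - u - (x - y) = y - u :> 'rV[R]_n by rewrite opprB addrC subrKA.
  have E2 x y u : y - u - (x - u) = y - x :> 'rV[R]_n by rewrite opprB subrKA.
  rewrite /= !E1 !E2.
  apply.
  - by have := strong _ (Zz s.+1); lra.
  - by have := strong _ (Zz s.+2); lra.
  - have := step s.+1 _ (Zz s.+1).
    by rewrite -(opprB (w s.+1) (z s.+1)) dotNr dotNl dotNr opprK; lra.
  - have := step s.+1 _ Zzs.
    by rewrite -(opprB (w s.+1) zs) dotNr dotNl dotNr opprK; lra.
have D0 : 0 <= D by have := diam _ _ Zzs Zzs; rewrite subrr enorm0.
have sqD x y : Z x -> Z y -> dot (x - y) (x - y) <= D ^+ 2.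
  by move=> Zx Zy; rewrite -enorm_le_sqr // diam.
have V0 : V 0%N <= 3 * (m * Q ^+ 2) * D ^+ 2 + del.
  have := step 0%N _ Zzs; rewrite w0 => h0.
  have hA : m * (Q ^+ 2 - 1) * dot (z 0%N - z 1%N) (z 0%N - z 1%N) <=
            A * dot (z 0%N - z 1%N) (z 0%N - z 1%N) by rewrite ler_wpM2r ?dot_ge0.
  have d1 := sqD _ _ (Zz 0%N) Zzs; have d2 := sqD _ _ (Zz 0%N) (Zz 1%N).
  have d3 := sqD _ _ (Zz 1%N) Zzs.
  rewrite /V /b; move: h0 hA d1 d2 d3.
  have -> : zs - z 0%N = - (z 0%N - zs) by rewrite opprB.
  have -> : z 1%N - z 0%N = - (z 0%N - z 1%N) by rewrite opprB.
  have -> : z 1%N - zs = (z 0%N - zs) - (z 0%N - z 1%N).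
    by rewrite opprB [RHS]addrC subrKA.
  move: (z 0%N - zs) (z 0%N - z 1%N) => p r.
  rewrite !dotE !opprK (dotC r p) => h0 hA d1 d2 d3.
  have : m * (Q ^+ 2 - Q) * (2 * dot p r) <= m * (Q ^+ 2 - Q) * (2 * D ^+ 2).
    rewrite ler_wpM2l ?mulr_ge0 ?(ltW m0) //; first by nra.
    by have := dot_ge0 (p - r); have := sqr_ge0 D; rewrite !dotE (dotC r p); lra.
  have : m * dot r r <= m * D ^+ 2 by rewrite ler_wpM2l // ltW.
  have : 0 <= m * (Q - 1) * D ^+ 2.
    by rewrite !mulr_ge0 ?sqr_ge0 ?(ltW m0) //; lra.
  have : 0 <= m * D ^+ 2 by rewrite mulr_ge0 ?sqr_ge0 ?(ltW m0).
  have : 0 <= m * Q ^+ 2 * D ^+ 2 by exact: mulr_ge0 (mulr_ge0 (ltW m0) (sqr_ge0 Q)) (sqr_ge0 D).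
  by lra.
have iter : V t <= (1 - (2 * Q)^-1) ^+ t * (3 * (m * Q ^+ 2) * D ^+ 2 + del) +
    4 * Q * del.
  elim: t => [|t IH].
    by rewrite expr0 mul1r (le_trans V0) // lerDl !mulr_ge0 // ltW.
  apply: (le_trans (VS t)).
  have r0 : 0 <= 1 - (2 * Q)^-1.
    by rewrite subr_ge0 invf_le1; lra.
  have := ler_wpM2l r0 IH; rewrite (exprS _ t) -(mulrA _ (_ ^+ t)).
  move: (_ ^+ t * _) => X.
  have -> : (1 - (2 * Q)^-1) * (X + 4 * Q * del) =
            (1 - (2 * Q)^-1) * X + 4 * Q * del - 2 * del by field; lra.
  by lra.
by have := dot_ge0 (b t); move: iter; rewrite /V; nra.
Qed.
End acceleration.

(** * Convex-concave functions *)

(** A function that is jointly l-smooth up to the exact quadratics of modulus s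
    in x and v in y. The expansion holds everywhere, whereas convexity in x is
    available only for y in Y and concavity in y only for x in X. Separating the
    quadratics from the smooth part keeps l fixed under regularization. *)
Record saddle_fun (R : realType) (m n : nat) (l s v : R)
    (X : set 'rV[R]_m) (Y : set 'rV[R]_n) (G : 'rV[R]_m -> 'rV[R]_n -> R)
    (Gx : 'rV[R]_m -> 'rV[R]_n -> 'rV[R]_m)
    (Gy : 'rV[R]_m -> 'rV[R]_n -> 'rV[R]_n) : Prop := SaddleFun {
  sf_expand : forall x y x' y',
    `|G x' y' - G x y - dot (Gx x y) (x' - x) - dot (Gy x y) (y' - y)
      - s / 2 * dot (x' - x) (x' - x) + v / 2 * dot (y' - y) (y' - y)|
    <= l / 2 * (dot (x' - x) (x' - x) + dot (y' - y) (y' - y));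
  sf_convex : forall x x' y, Y y ->
    G x y + dot (Gx x y) (x' - x) + s / 2 * dot (x' - x) (x' - x) <= G x' y;
  sf_concave : forall x y y', X x ->
    G x y' <= G x y + dot (Gy x y) (y' - y) - v / 2 * dot (y' - y) (y' - y);
  sf_lipschitz : forall x y x' y',
    dot (Gx x' y' - Gx x y - s *: (x' - x)) (Gx x' y' - Gx x y - s *: (x' - x))
    + dot (Gy x' y' - Gy x y + v *: (y' - y)) (Gy x' y' - Gy x y + v *: (y' - y))
    <= l ^+ 2 * (dot (x' - x) (x' - x) + dot (y' - y) (y' - y)) }.

Section saddle_fun_theory.
Context {R : realType}.

Lemma saddle_fun_swap m n (l s v : R) (X : set 'rV[R]_m) (Y : set 'rV[R]_n)
    G Gx Gy : saddle_fun l s v X Y G Gx Gy ->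
  saddle_fun l v s Y X (fun y x => - G x y) (fun y x => - Gy x y)
    (fun y x => - Gx x y).
Proof.
case=> he hx hy hl; split.
- move=> y x y' x'; have := he x y x' y'; rewrite !dotNl !ler_norml.
  by move=> /andP[h1 h2]; apply/andP; split; lra.
- by move=> y y' x Xx; have := hy x y y' Xx; rewrite !dotNl; lra.
- by move=> y x x' Yy; have := hx x x' y Yy; rewrite !dotNl; lra.
- move=> y x y' x'; have := hl x y x' y'; rewrite (addrC (dot (y' - y) _)).
  have -> : - Gx x' y' - - Gx x y + s *: (x' - x)
     = - (Gx x' y' - Gx x y - s *: (x' - x)) by rewrite !opprD !opprK.
  have -> : - Gy x' y' - - Gy x y - v *: (y' - y)
     = - (Gy x' y' - Gy x y + v *: (y' - y)) by rewrite !opprD !opprK.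
  by rewrite ![dot (- _) (- _)]dotNl !dotNr !opprK; lra.
Qed.

(** Adding a proximal term only raises the modulus of strong convexity; the
    part of the function that is merely smooth is unchanged. *)
Lemma saddle_fun_prox m n (l s v r : R) (X : set 'rV[R]_m) (Y : set 'rV[R]_n)
    G Gx Gy (w : 'rV[R]_m) : saddle_fun l s v X Y G Gx Gy ->
  saddle_fun l (s + r) v X Y (fun x y => G x y + r / 2 * enorm (x - w) ^+ 2)
    (fun x y => Gx x y + r *: (x - w)) Gy.
Proof.
have sq x x' : dot (x' - w) (x' - w) = dot (x - w) (x - w)
    + 2 * dot (x - w) (x' - x) + dot (x' - x) (x' - x) :> R.
  by rewrite !dotE (dotC w x) (dotC w x') (dotC x' x); ring.
case=> he hx hy hl; split.
- move=> x y x' y'; have := he x y x' y'; rewrite !enorm_sqr (sq x x') [dot (_ + r *: _) _]dotDl dotZl.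
  by rewrite !ler_norml => /andP[h1 h2]; apply/andP; split; lra.
- move=> x x' y Yy; have := hx x x' y Yy; rewrite !enorm_sqr (sq x x') [dot (_ + r *: _) _]dotDl dotZl.
  by lra.
- by move=> x y y' Xx; have := hy x y y' Xx; lra.
- move=> x y x' y'; have := hl x y x' y'.
  have -> // : Gx x' y' + r *: (x' - w) - (Gx x y + r *: (x - w)) - (s + r) *: (x' - x)
    = Gx x' y' - Gx x y - s *: (x' - x).
  by apply/rowP => i; rewrite !mxE; ring.
Qed.

End saddle_fun_theory.

(** First-order optimality over Z of z, for a function of gradient g at z. *)
Definition stationary (R : realType) (n : nat) (Z : set 'rV[R]_n)
    (g z : 'rV[R]_n) : Prop :=
  Z z /\ forall z', Z z' -> 0 <= dot g (z' - z).

Section stationary_theory.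
Context {R : realType} {n : nat} (Z : set 'rV[R]_n) (bZ : body Z).
Implicit Types (g z : 'rV[R]_n).

Lemma stationary_proj g z t : 0 <= t -> stationary Z g z -> proj Z (z - t *: g) = z.
Proof.
move=> t0 [Zz hz]; apply: proj_unique => // q Zq.
by rewrite [z - _ - z]addrAC subrr add0r dotNl dotZl oppr_le0 mulr_ge0 ?hz.
Qed.

(** A small step of the projected gradient map certifies nearness to the
    stationary point of a strongly monotone field. *)
Lemma stationary_residual (mu t : R) (g g' gs z zs : 'rV[R]_n) :
  0 < t -> stationary Z gs zs ->
  let z' := proj Z (z - t *: g) in
  mu * dot (z' - zs) (z' - zs) <= dot (g' - gs) (z' - zs) ->
  mu * enorm (z' - zs) <= enorm (g' - g) + t^-1 * enorm (z - z').
Proof.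
move=> t0 [Zzs hzs] z' hmono.
have Zz' : Z z' by exact: proj_in.
apply: ler_cancel_sqr; rewrite ?enorm_ge0 //.
  by rewrite addr_ge0 ?mulr_ge0 ?enorm_ge0 // invr_ge0 ltW.
rewrite enorm_sqr (le_trans hmono) //.
have h1 := hzs _ Zz'.
have h2 := proj_obtuse (z - t *: g) bZ Zzs; rewrite -/z' in h2.
have h3 := dot_le_enorm (g' - g) (z' - zs).
have h4 := dot_le_enorm (z - z') (z' - zs).
have {}h4 : dot (z - z') (z' - zs) / t <= enorm (z - z') * enorm (z' - zs) / t.
  by rewrite ler_pM2r ?invr_gt0.
have h5 : dot g (z' - zs) <= dot (z - z') (z' - zs) / t.
  rewrite ler_pdivlMr //; move: h2; rewrite !dotE; lra.
move: h1 h3 (le_trans h5 h4); rewrite !dotE; lra.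
Qed.

End stationary_theory.

Section saddle_fun_bounds.
Context {R : realType} {m n : nat} (l s v : R).
Context (X : set 'rV[R]_m) (Y : set 'rV[R]_n).
Context (G : 'rV[R]_m -> 'rV[R]_n -> R).
Context (Gx : 'rV[R]_m -> 'rV[R]_n -> 'rV[R]_m).
Context (Gy : 'rV[R]_m -> 'rV[R]_n -> 'rV[R]_n).
Hypotheses (l0 : 0 < l) (s0 : 0 <= s) (v0 : 0 <= v).
Hypothesis hG : saddle_fun l s v X Y G Gx Gy.

Lemma sf_grad_x y : quad_grad setT (fun x => G x y) (fun x => Gx x y) ((l + s) / 2).
Proof.
move=> x x' _ _; have := sf_expand hG x y x' y.
rewrite subrr !dot0r !mulr0 !(subr0, addr0).
rewrite !ler_norml; have := dot_ge0 (x' - x).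
set a := dot (x' - x) _ => a0 /andP[h1 h2].
have sa := mulr_ge0 s0 a0; have la := mulr_ge0 (ltW l0) a0.
by apply/andP; split; lra.
Qed.

Lemma sf_gradx y x : grad (fun u => G u y) x = Gx x y.
Proof. exact: quad_grad_grad (sf_grad_x y). Qed.

Lemma sf_lip_x_resid x x' y :
  enorm (Gx x' y - Gx x y - s *: (x' - x)) <= l * enorm (x' - x).
Proof.
rewrite enorm_le_sqr ?mulr_ge0 ?enorm_ge0 ?(ltW l0) // exprMn enorm_sqr.
have := sf_lipschitz hG x y x' y; rewrite subrr dot0l addr0.
by move=> h; apply: le_trans h; rewrite lerDl dot_ge0.
Qed.

Lemma sf_lip_x x x' y y' :
  enorm (Gx x' y' - Gx x y) <= (l + s) * enorm (x' - x) + l * enorm (y' - y).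
Proof.
have h : enorm (Gx x' y' - Gx x y - s *: (x' - x)) <= l * enorm (x' - x) + l * enorm (y' - y).
  rewrite enorm_le_sqr; last by rewrite addr_ge0 // mulr_ge0 ?enorm_ge0 ?(ltW l0).
  have := sf_lipschitz hG x y x' y'; rewrite -!(enorm_sqr (_ - _)) -enorm_sqr.
  have := sqr_ge0 (enorm (Gy x' y' - Gy x y + v *: (y' - y))).
  have := mulr_ge0 (sqr_ge0 l) (mulr_ge0 (enorm_ge0 (x' - x)) (enorm_ge0 (y' - y))).
  by lra.
have -> : Gx x' y' - Gx x y = (Gx x' y' - Gx x y - s *: (x' - x)) + s *: (x' - x).
  by rewrite subrK.
apply: (le_trans (ler_enormD _ _)); rewrite enormZ (ger0_norm s0); lra.
Qed.

Lemma sf_argmin_x y : body X -> exists x, stationary X (Gx x y) x.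
Proof.
move=> bX.
have hx : quad_grad X (fun x => G x y) (fun x => Gx x y) ((l + s) / 2).
  by move=> x x' _ _; exact: sf_grad_x.
have [x Xx xmin] := quad_grad_argmin bX hx.
by exists x; split=> //; exact: argmin_first_order hx Xx xmin.
Qed.

Lemma sf_stationary_min x y x' : Y y -> stationary X (Gx x y) x -> X x' ->
  G x y + s / 2 * dot (x' - x) (x' - x) <= G x' y.
Proof.
by move=> Yy [_ hx] Xx'; have := hx _ Xx'; have := sf_convex hG x x' Yy; lra.
Qed.

(** Comparing the optimality conditions at both points by strong
    monotonicity of the gradient in x. *)
Lemma sf_stationary_lipschitz x y x' y' : Y y -> Y y' ->
  stationary X (Gx x y) x -> stationary X (Gx x' y') x' ->
  s * enorm (x' - x) <= l * enorm (y' - y).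
Proof.
move=> Yy Yy' [Xx hx] [Xx' hx'].
apply: ler_cancel_sqr; rewrite ?mulr_ge0 ?enorm_ge0 ?(ltW l0) // enorm_sqr.
have h1 := hx _ Xx'; have h2 := hx' _ Xx.
have h3 := sf_convex hG x x' Yy; have h4 := sf_convex hG x' x Yy.
have h5 := dot_le_enorm (Gx x' y - Gx x' y') (x' - x).
have h6 : enorm (Gx x' y - Gx x' y') * enorm (x' - x) <= l * enorm (y' - y) * enorm (x' - x).
  rewrite ler_wpM2r ?enorm_ge0 // (enormB y').
  by have := sf_lip_x x' x' y' y; rewrite subrr enorm0 mulr0 add0r.
move: h1 h2 h3 h4 h5; rewrite !dotE; lra.
Qed.

(** A feasible x bounds the optimal value at y' by the concave function G x:
    this makes the dual function strongly concave, with slope Gy x y when x is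
    optimal at y. *)
Lemma sf_dual_upper x y x' y' : X x -> Y y' -> stationary X (Gx x' y') x' ->
  G x' y' <= G x y + dot (Gy x y) (y' - y) - v / 2 * dot (y' - y) (y' - y).
Proof.
move=> Xx Yy' hx'; have := sf_concave hG y y' Xx.
have := sf_stationary_min Yy' hx' Xx; have := dot_ge0 (x - x').
have := mulr_ge0 s0 (dot_ge0 (x - x')); lra.
Qed.

Lemma sf_dual_monotone x y x' y' : Y y -> Y y' ->
  stationary X (Gx x y) x -> stationary X (Gx x' y') x' ->
  v * dot (y' - y) (y' - y) <= dot (Gy x y - Gy x' y') (y' - y).
Proof.
move=> Yy Yy' hx hx'.
have := sf_dual_upper y (proj1 hx) Yy' hx'.
have := sf_dual_upper y' (proj1 hx') Yy hx.
by rewrite !dotE (dotC y' y); lra.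
Qed.

(** Moving y to y' tilts the strongly convex problem in x by at most l times
    the displacement, so its value drops by at most l^2 / (2 s) times the
    square: this keeps the smoothness of the dual function of order l^2 / s. *)
Lemma sf_dual_lower x y x' y' : 0 < s -> Y y' -> stationary X (Gx x y) x -> X x' ->
  G x y + dot (Gy x y) (y' - y)
    - (l ^+ 2 / (2 * s) + (l + v) / 2) * dot (y' - y) (y' - y) <= G x' y'.
Proof.
move=> s_gt0 Yy' [Xx hx] Xx'.
have h1 := sf_convex hG x x' Yy'.
have h2 := hx _ Xx'.
have := sf_expand hG x y x y'; rewrite subrr !dot0r !mulr0 !(subr0, add0r).
rewrite ler_norml => /andP[h3 _].
have h4 : - dot (Gx x y' - Gx x y) (x' - x) <=
    s / 2 * dot (x' - x) (x' - x) + (2 * s)^-1 * (l ^+ 2 * dot (y' - y) (y' - y)).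
  rewrite -dotNl dotC; apply: le_trans (dot_young _ _ s_gt0) _.
  rewrite lerD2l ler_wpM2l ?invr_ge0 ?mulr_ge0 ?(ltW s_gt0) //.
  rewrite dotNl dotNr opprK -!enorm_sqr -exprMn.
  rewrite ler_pXn2r ?nnegrE ?mulr_ge0 ?enorm_ge0 ?(ltW l0) //.
  by have := sf_lip_x x x y y'; rewrite subrr enorm0 mulr0 add0r.
have {}h4 : dot (Gx x y) (x' - x) - dot (Gx x y') (x' - x) <=
    s / 2 * dot (x' - x) (x' - x) + l ^+ 2 / (2 * s) * dot (y' - y) (y' - y).
  by move: h4; rewrite dotDl dotNl opprD opprK addrC mulrA (mulrC _ (l ^+ 2)).
by lra.
Qed.

(** With modulus s at least l, the problem in x is convex for every y, even
    where G is not, and its value is still smooth in y. *)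
Lemma sf_dual_lower_weak x y x' y' : l <= s -> stationary X (Gx x y) x -> X x' ->
  G x y + dot (Gy x y) (y' - y) - (l + v) / 2 * dot (y' - y) (y' - y) <= G x' y'.
Proof.
move=> ls [Xx hx] Xx'; have h2 := hx _ Xx'.
have := sf_expand hG x y x' y'; rewrite ler_norml => /andP[h3 _].
have := mulr_ge0 (_ : 0 <= s - l) (dot_ge0 (x' - x)).
by rewrite subr_ge0 => /(_ ls); lra.
Qed.

(** Danskin: the value h y of the problem in x has gradient Gy there, so at a
    maximizer of h the first-order conditions in x and in y hold together. *)
Lemma sf_saddle : 0 < s -> body X -> body Y ->
  exists x y, stationary X (Gx x y) x /\ stationary Y (- Gy x y) y.
Proof.
move=> s_gt0 bX bY.
have [xs hxs] := choice (fun y => sf_argmin_x y bX).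
have hq : quad_grad Y (fun y => - G (xs y) y) (fun y => - Gy (xs y) y)
    (l ^+ 2 / (2 * s) + (l + v) / 2).
  move=> y y' Yy Yy'.
  have := sf_dual_upper y (proj1 (hxs y)) Yy' (hxs y').
  have := sf_dual_lower s_gt0 Yy' (hxs y) (proj1 (hxs y')).
  have := mulr_ge0 v0 (dot_ge0 (y' - y)).
  have : 0 <= l ^+ 2 / (2 * s) * dot (y' - y) (y' - y).
    by rewrite mulr_ge0 ?dot_ge0 // divr_ge0 ?sqr_ge0 // mulr_ge0 // ltW.
  have := mulr_ge0 (ltW l0) (dot_ge0 (y' - y)).
  by rewrite ler_norml !dotNl; move=> *; apply/andP; split; lra.
have [y Yy ymin] := quad_grad_argmin bY hq.
exists (xs y), y; split; first exact: hxs.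
by split=> //; exact: argmin_first_order hq Yy ymin.
Qed.

End saddle_fun_bounds.

Section near_saddle.
Context {R : realType} {m n : nat} (l s v : R).
Context (X : set 'rV[R]_m) (Y : set 'rV[R]_n).
Context (G : 'rV[R]_m -> 'rV[R]_n -> R).
Context (Gx : 'rV[R]_m -> 'rV[R]_n -> 'rV[R]_m).
Context (Gy : 'rV[R]_m -> 'rV[R]_n -> 'rV[R]_n).
Hypotheses (l0 : 0 < l) (s0 : 0 <= s) (v0 : 0 < v).
Hypothesis hG : saddle_fun l s v X Y G Gx Gy.

(** The counterpart of sf_dual_lower for the maximum over y. *)
Lemma sf_primal_upper x y x' y' : X x' -> Y y' -> stationary Y (- Gy x y) y ->
  G x' y' <= G x y + dot (Gx x y) (x' - x)
    + (l ^+ 2 / (2 * v) + (l + s) / 2) * dot (x' - x) (x' - x).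
Proof.
move=> Xx' Yy' hy.
have := sf_dual_lower l0 (ltW v0) (saddle_fun_swap hG) v0 Xx' hy Yy'.
by rewrite dotNl; lra.
Qed.

(** One projected gradient step from a point near the saddle point: the error
    of the gradient enters only multiplied by the displacement, so the
    suboptimality is quadratic in the distances although the gradient at the
    saddle point may be arbitrarily large. *)
Lemma sf_saddle_step (c a b : R) x y xh yh :
  s <= 3 * l -> 4 * v <= l -> 2 <= c -> c <= 18 -> body X ->
  stationary X (Gx xh yh) xh -> stationary Y (- Gy xh yh) yh ->
  enorm (x - xh) <= a -> enorm (y - yh) <= b ->
  forall y', Y y' ->
  G (proj X (x - (c * (l / v) * l)^-1 *: Gx x y)) y'
    <= G xh yh + 20 * (l / v) * l * (3 * a + b) ^+ 2.
Proof.
move=> sl vl c2 c18 bX hx hy ha hb y' Yy'.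
have [[l_gt0 s_ge0] v_gt0] := (l0, s0, v0).
set k := l / v; set t := _^-1; set out := proj X _.
have k4 : 4 <= k by rewrite ler_pdivlMr.
have kv : k * v = l by rewrite divfK ?gt_eqF.
have a0 : 0 <= a by exact: le_trans (enorm_ge0 _) ha.
have b0 : 0 <= b by exact: le_trans (enorm_ge0 _) hb.
have kl0 : 0 < k * l by rewrite mulr_gt0 //; lra.
have L0 : 0 < c * k * l by rewrite -mulrA mulr_gt0 //; lra.
have t0 : 0 < t by rewrite invr_gt0.
have tL : t * (c * k * l) = 1 by rewrite mulVf ?gt_eqF.
have tl : t * l <= 8^-1.
  have : t * l * 8 <= t * l * (c * k).
    by rewrite ler_wpM2l ?mulr_ge0 ?(ltW t0) ?(ltW l0) //; nra.
  by lra.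
have Xout : X out by exact: proj_in.
set u := Gx x y in out Xout *; set g := Gx xh yh.
have eg : enorm (u - g) <= 4 * l * a + l * b.
  apply: le_trans (sf_lip_x l0 s0 hG _ _ _ _) _.
  have := ler_wpM2l (ltW l0) hb.
  have ls0 : 0 <= l + s by lra.
  have ls4 : l + s <= 4 * l by lra.
  by have := ler_pM ls0 (enorm_ge0 (x - xh)) ls4 ha; lra.
set E := enorm (out - xh).
have E0 : 0 <= E by exact: enorm_ge0.
(* xh is fixed by the step with its own gradient *)
have eE : E <= 2 * a + b.
  rewrite /E -[xh in out - xh](stationary_proj bX (ltW t0) hx).
  apply: le_trans (proj_lipschitz _ _ bX) _.
  have -> : x - t *: u - (xh - t *: g) = (x - xh) - t *: (u - g).
    by apply/rowP => i; rewrite !mxE; ring.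
  apply: le_trans (ler_enormB _ _) _; rewrite enormZ (ger0_norm (ltW t0)).
  have h1 := ler_wpM2l (ltW t0) eg.
  have h2 : t * l * (4 * a + b) <= 8^-1 * (4 * a + b) by rewrite ler_wpM2r //; lra.
  by lra.
have exo : enorm (x - out) <= 3 * a + b.
  by apply: le_trans (ler_enorm_sub xh _ _) _; rewrite (enormB xh) -/E; lra.
(* the variational inequality satisfied by out removes the gradient itself and
   leaves its error and the displacement *)
have lin : dot g (out - xh) <= enorm (u - g) * E + c * k * l * (enorm (x - out) * E).
  have h1 := proj_obtuse (x - t *: u) bX (proj1 hx); rewrite -/out in h1.
  have h2 := dot_le_enorm (x - out) (out - xh).
  have h3 := dot_le_enorm (g - u) (out - xh).
  rewrite (enormB g) in h3.
  have h4 : t * dot u (out - xh) <= dot (x - out) (out - xh).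
    by move: h1; rewrite !dotE; lra.
  have h5 := ler_wpM2l (ltW L0) (le_trans h4 h2).
  rewrite mulrA (mulrC _ t) tL mul1r -/E in h5.
  by move: h3; rewrite dotDl dotNl -/E; lra.
have := sf_primal_upper Xout Yy' hy; rewrite -/g -enorm_sqr -/E.
have -> : l ^+ 2 / (2 * v) = k * l / 2 by rewrite /k; field; lra.
have h1 : enorm (u - g) * E <= k * l / 2 * (3 * a + b) ^+ 2.
  rewrite expr2 mulrA; apply: ler_pM; rewrite ?enorm_ge0 //; last by lra.
  apply: le_trans eg _.
  have : 4 * l * (3 * a + b) <= k * l * (3 * a + b).
    by rewrite ler_wpM2r ?ler_wpM2r ?(ltW l0) //; lra.
  have := mulr_ge0 (ltW l0) a0; have := mulr_ge0 (ltW l0) b0; lra.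
have h2 : c * k * l * (enorm (x - out) * E) <= 18 * (k * l) * (3 * a + b) ^+ 2.
  apply: ler_pM; [exact: ltW | by rewrite mulr_ge0 ?enorm_ge0 | |].
    by rewrite -mulrA ler_wpM2r // ltW.
  by rewrite expr2; apply: ler_pM; rewrite ?enorm_ge0 //; lra.
have h3 : (k * l / 2 + (l + s) / 2) * E ^+ 2 <= k * l * (3 * a + b) ^+ 2.
  apply: ler_pM; rewrite ?sqr_ge0 //.
  - by rewrite addr_ge0 // divr_ge0 ?(ltW kl0) //; lra.
  - by nra.
  - by rewrite ler_pXn2r ?nnegrE //; lra.
have := mulr_ge0 (ltW kl0) (sqr_ge0 (3 * a + b)); lra.
Qed.

End near_saddle.

(** * Termination of the inner procedure *)

Lemma first_stop_exists (P : nat -> Prop) t0 : (1 <= t0)%N -> P t0 ->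
  exists2 t, first_stop P t & (t <= t0)%N.
Proof.
move=> t0_gt0 Pt0; pose p := [pred s | (1 <= s)%N && `[< P s >]].
have ex : exists s, p s by exists t0; rewrite /= t0_gt0; apply/asboolP.
case: (ex_minnP ex) => t /andP[t_gt0 /asboolP Pt] tmin.
exists t; last by apply: tmin; rewrite /= t0_gt0; apply/asboolP.
split=> // s /andP[s_gt0 st] Ps; have := tmin s; rewrite /= s_gt0 leqNgt st.
by have -> : `[< P s >] by [apply/asboolP] => /(_ isT).
Qed.

Lemma ler_wpdiv2l (R : realFieldType) (x y z : R) : 0 <= x -> 0 < y -> y <= z ->
  x / z <= x / y.
Proof.
move=> x0 y0 yz; rewrite ler_wpM2l // lef_pV2 ?posrE //.
exact: lt_le_trans yz.
Qed.

Section gradient_descent.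
Context {R : realType} {n : nat}.
Implicit Types (Z : set 'rV[R]_n) (h : 'rV[R]_n -> R).

(** The iteration itself is always defined, so it terminates as soon as the
    stopping test is known to hold at some time t0. *)
Lemma AGD_exists h Z z0 (L m tau : R) t0 : L <> m -> body Z ->
  let step w := proj Z (w - L^-1 *: grad h w) in
  let theta := (Num.sqrt (L / m) - 1) / (Num.sqrt (L / m) + 1) in
  (1 <= t0)%N ->
  (forall z zt : nat -> 'rV[R]_n, z 0%N = z0 -> zt 0%N = z0 ->
     (forall s, z s.+1 = step (zt s) /\
                zt s.+1 = z s.+1 + theta *: (z s.+1 - z s)) ->
     enorm (z t0 - step (z t0)) ^+ 2 <= tau / (2 * (L / m) ^+ 2 * (L - m))) ->
  exists out N u, [/\ AGD h Z z0 L m tau out N, (N <= 2 * t0)%N, Z u,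
    out = step u &
    enorm (u - step u) ^+ 2 <= tau / (2 * (L / m) ^+ 2 * (L - m))].
Proof.
move=> Lm bZ step theta t0_gt0 hstop.
have [z [zt [z_0 zt_0 hz]]] : exists z zt : nat -> 'rV[R]_n, [/\ z 0%N = z0, zt 0%N = z0 &
    forall s, z s.+1 = step (zt s) /\ zt s.+1 = z s.+1 + theta *: (z s.+1 - z s)].
  pose next (p : 'rV[R]_n * 'rV[R]_n) :=
    (step p.2, step p.2 + theta *: (step p.2 - p.1)).
  by exists (fun s => (iter s next (z0, z0)).1), (fun s => (iter s next (z0, z0)).2).
have st0 := hstop z zt z_0 zt_0 hz.
have [t ft tt0] := first_stop_exists t0_gt0 (or_intror st0 : (fun s => L = m \/
  enorm (z s - step (z s)) ^+ 2 <= tau / (2 * (L / m) ^+ 2 * (L - m))) t0).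
exists (step (z t)), (2 * t)%N, (z t); split.
- by exists z, zt, t; split.
- by rewrite leq_mul2l.
- by case: ft => + _ _; case: t tt0 => // t _ _; rewrite (proj1 (hz t)); exact: proj_in.
- by [].
- clear st0; case: ft => _ [/Lm|ht _]; [by []|exact: ht].
Qed.

(** At condition number 3 / 2 the momentum is at most 1 / 8, and the contraction
    of the gradient step by 2 / 3 dominates the extrapolation: the rate
    r = 9 / 10 satisfies 2 / 3 (9 / 8 r + 1 / 8) <= r^2. *)
Lemma AGD_contractive h Z z0 zs (l tau D : R) t0 :
  0 < l -> body Z -> (forall x y, Z x -> Z y -> enorm (x - y) <= D) -> Z z0 -> Z zs ->
  let step w := proj Z (w - (3 * l)^-1 *: grad h w) in
  (forall w w', enorm (step w - step w') <= 2 / 3 * enorm (w - w')) ->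
  step zs = zs -> (1 <= t0)%N ->
  (9 / 10) ^+ t0 * (5 / 3 * D) <= Num.sqrt (2 / 9 * (tau / l)) -> 0 <= tau ->
  exists out N, [/\ AGD h Z z0 (3 * l) (2 * l) tau out N, Z out,
    enorm (out - zs) ^+ 2 <= tau / l & (N <= 2 * t0)%N].
Proof.
move=> l0 bZ diam Zz0 Zzs step contr fix_zs t0_gt0 ht0 tau0.
have D0 : 0 <= D by have := diam _ _ Zzs Zzs; rewrite subrr enorm0.
have k32 : 3 * l / (2 * l) = 3 / 2 by field; lra.
have thrE : tau / (2 * (3 * l / (2 * l)) ^+ 2 * (3 * l - 2 * l)) = 2 / 9 * (tau / l).
  by rewrite k32; field; lra.
have tl0 : 0 <= tau / l by rewrite divr_ge0 // ltW.
set theta := (Num.sqrt (3 * l / (2 * l)) - 1) / (Num.sqrt (3 * l / (2 * l)) + 1).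
have [th0 th8] : 0 <= theta /\ theta <= 8^-1.
  rewrite /theta k32.
  have s1 : 1 <= Num.sqrt (3 / 2 : R).
    by rewrite -[leLHS]sqrtr1 ler_wsqrtr //; lra.
  have s2 : Num.sqrt (3 / 2 : R) <= 9 / 7.
    have -> : 9 / 7 = Num.sqrt ((9 / 7) ^+ 2) :> R by rewrite sqrtr_sqr ger0_norm //; lra.
    by rewrite ler_wsqrtr //; lra.
  split; first by rewrite divr_ge0 //; lra.
  by rewrite ler_pdivrMr; lra.
have Lm : 3 * l <> 2 * l by lra.
have [z zt z_0 zt_0 hz|out [N [u [hA hN Zu outE hu]]]] :=
    @AGD_exists h Z z0 (3 * l) (2 * l) tau t0 Lm bZ t0_gt0.
  rewrite thrE -(sqr_sqrtr (_ : 0 <= 2 / 9 * (tau / l))); last by lra.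
  rewrite ler_pXn2r ?nnegrE ?enorm_ge0 ?sqrtr_ge0 //; apply: le_trans ht0.
  (* two consecutive errors, since the extrapolation involves both *)
  have dec s : enorm (z s - zs) <= (9 / 10) ^+ s * D /\
      enorm (z s.+1 - zs) <= (9 / 10) ^+ s.+1 * D.
    have st w : enorm (step w - zs) <= 2 / 3 * enorm (w - zs).
      by rewrite -[in step w - zs]fix_zs contr.
    elim: s => [|s [IH1 IH2]].
      rewrite expr0 mul1r z_0 diam //; split=> //.
      rewrite (proj1 (hz 0%N)) zt_0 expr1; apply: le_trans (st _) _.
      by have := diam _ _ Zz0 Zzs; lra.
    split=> //; rewrite (proj1 (hz s.+1)) (proj2 (hz s)).
    apply: le_trans (st _) _.
    have -> : z s.+1 + theta *: (z s.+1 - z s) - zs =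
        (1 + theta) *: (z s.+1 - zs) - theta *: (z s - zs).
      by apply/rowP => i; rewrite !mxE; ring.
    have := ler_enormB ((1 + theta) *: (z s.+1 - zs)) (theta *: (z s - zs)).
    rewrite !enormZ (ger0_norm th0) (ger0_norm (_ : 0 <= 1 + theta)); last by lra.
    have := enorm_ge0 (z s.+1 - zs); have := enorm_ge0 (z s - zs).
    move: IH1 IH2; rewrite !exprS; move: (_ ^+ s) (enorm _) (enorm _) (enorm _).
    by move=> p a b c; nra.
  have [h1 _] := dec t0.
  apply: le_trans (ler_enorm_sub zs _ _) _; rewrite (enormB zs).
  have h2 : enorm (step (z t0) - zs) <= 2 / 3 * enorm (z t0 - zs).
    by rewrite -[in step _ - zs]fix_zs contr.
  by rewrite -/(step (z t0)); lra.
exists out, N; split=> //; first by rewrite outE; exact: proj_in.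
have {}outE : out = step u := outE.
rewrite thrE -/(step u) -outE in hu.
have h1 : enorm (out - zs) <= 2 / 3 * enorm (u - zs).
  by rewrite -[in out - zs]fix_zs outE contr.
have h2 := ler_enorm_sub out u zs.
have h3 : enorm (out - zs) <= 2 * enorm (u - out) by lra.
apply: (@le_trans _ _ ((2 * enorm (u - out)) ^+ 2)).
  by rewrite ler_pXn2r ?nnegrE ?mulr_ge0 ?enorm_ge0.
by rewrite exprMn; lra.
Qed.

(** The step 1 / l exceeds the inverse of the smoothness constant l + m, so the
    three-point inequality holds with (l - m) / 2 instead of l / 2; this loss is
    of relative size m / l, as accel_rate allows. *)
Lemma AGD_accelerated h (gh : 'rV[R]_n -> 'rV[R]_n) Z z0 zs (l m tau D : R) t0 :
  0 < m -> 100 * (100 * m) <= l -> body Z ->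
  (forall x y, Z x -> Z y -> enorm (x - y) <= D) -> Z z0 ->
  (forall w, grad h w = gh w) ->
  (forall w z, h z <= h w + dot (gh w) (z - w) + (l + m) / 2 * dot (z - w) (z - w)) ->
  (forall w z, h w + dot (gh w) (z - w) + m / 2 * dot (z - w) (z - w) <= h z) ->
  (forall w z, enorm (gh z - gh w) <= (l + m) * enorm (z - w)) ->
  stationary Z (gh zs) zs -> 0 <= tau ->
  (1 - (2 * Num.sqrt (l / m))^-1) ^+ t0 * (3 * l * D ^+ 2)
    <= tau / (64 * (l / m) ^+ 3) ->
  exists out N, [/\ AGD h Z z0 l m tau out N, Z out,
    enorm (out - zs) ^+ 2 <= 9 * (tau / l) & (N <= 2 * t0.+1)%N].
Proof.
move=> m0 ml bZ diam Zz0 ghE hup hlow hlip stat tau0 ht0.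
have l0 : 0 < l by lra.
have [Zzs hzs] := stat.
set Q := Num.sqrt (l / m).
have k0 : 0 < l / m by rewrite divr_gt0.
have Q2 : Q ^+ 2 = l / m by rewrite sqr_sqrtr // ltW.
have mQ2 : m * Q ^+ 2 = l by rewrite Q2 mulrCA divff ?mulr1 // gt_eqF.
have Q0 : 0 <= Q by exact: sqrtr_ge0.
have Q100 : 100 <= Q.
  rewrite -(ler_pXn2r (_ : (0 < 2)%N)) ?nnegrE // Q2 ler_pdivlMr //; lra.
have Lm : l <> m by lra.
have k2 : 0 < (l / m) ^+ 2 by rewrite exprn_gt0.
have lm0 : 0 < l - m by lra.
have thr_ge : tau / (2 * (l / m) ^+ 2 * l) <= tau / (2 * (l / m) ^+ 2 * (l - m)).
  apply: ler_wpdiv2l => //; first exact: mulr_gt0 (mulr_gt0 (ltr0Sn _ 1) k2) lm0.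
  by rewrite (ler_pM2l (mulr_gt0 (ltr0Sn _ 1) k2)); lra.
have thr_le : tau / (2 * (l / m) ^+ 2 * (l - m)) <= tau / ((l / m) ^+ 2 * l).
  apply: ler_wpdiv2l => //; first exact: mulr_gt0 k2 l0.
  rewrite (mulrC 2) -[leRHS]mulrA ler_wpM2l ?(ltW k2) //; lra.
have strong x : Z x -> h zs + m / 2 * dot (x - zs) (x - zs) <= h x.
  by move=> Zx; have := hlow zs x; have := hzs _ Zx; lra.
have [z zt z_0 zt_0 hz|out [N [u [hA hN Zu outE hu]]]] :=
    @AGD_exists h Z z0 l m tau t0.+1 Lm bZ (ltn0Sn _).
  apply: le_trans thr_ge.
  have Zz s : Z (z s).
    by case: s => [|s]; rewrite ?z_0 // (proj1 (hz s)); exact: proj_in.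
  have hstep s x : Z x ->
     h (z s.+1) + (l - m) / 2 * dot (zt s - z s.+1) (zt s - z s.+1)
       + m * Q ^+ 2 * dot (zt s - z s.+1) (x - zt s)
       + m / 2 * dot (x - zt s) (x - zt s) - 0 <= h x.
    move=> Zx; rewrite mQ2.
    have h1 := hlow (zt s) x; have h2 := hup (zt s) (z s.+1).
    have h3 := proj_obtuse (zt s - l^-1 *: gh (zt s)) bZ Zx.
    rewrite -ghE -(proj1 (hz s)) ghE in h3.
    have {}h3 : l * dot (zt s - z s.+1) (x - z s.+1) <= dot (gh (zt s)) (x - z s.+1).
      move: h3; rewrite [_ - _ - z s.+1]addrAC [dot (_ - _ - _) _]dotDl dotNl dotZl.
      by rewrite subr_le0 ler_pdivlMl.
    have E : dot (z s.+1 - zt s) (z s.+1 - zt s) = dot (zt s - z s.+1) (zt s - z s.+1).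
      by rewrite -opprB dotNl dotNr opprK.
    rewrite E in h2; move: h1 h2 h3.
    have -> : z s.+1 - zt s = - (zt s - z s.+1) by rewrite opprB.
    have -> : x - z s.+1 = (x - zt s) + (zt s - z s.+1) by rewrite subrKA.
    move: (zt s - z s.+1) (x - zt s) => d e; rewrite !(dotDr, dotNr); lra.
  have mA : m * (Q ^+ 2 - 1) <= l - m by rewrite mulrBr mQ2 mulr1.
  have := accel_rate m0 Q100 mA (lexx 0) diam Zzs Zz (etrans zt_0 (esym z_0))
    (fun s => proj2 (hz s)) strong hstep t0.
  rewrite mQ2 mulr0 !addr0 => hV.
  have {}hV := le_trans hV ht0.
  have h1 := strong _ (Zz t0.+1).
  pose st w := proj Z (w - l^-1 *: grad h w); rewrite -/(st (z t0.+1)).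
  have h2 : enorm (z t0.+1 - st (z t0.+1)) <= 4 * enorm (z t0.+1 - zs).
    apply: le_trans (ler_enorm_sub zs _ _) _.
    set zz := z t0.+1.
    have := proj_lipschitz (zs - l^-1 *: gh zs) (zz - l^-1 *: gh zz) bZ.
    rewrite (stationary_proj bZ _ stat) ?invr_ge0 ?(ltW l0) // -[in proj Z _]ghE -/(st zz).
    have -> : zs - l^-1 *: gh zs - (zz - l^-1 *: gh zz) =
       l^-1 *: (gh zz - gh zs) - (zz - zs).
      by apply/rowP => i; rewrite !mxE; ring.
    have := ler_enormB (l^-1 *: (gh zz - gh zs)) (zz - zs).
    rewrite enormZ (ger0_norm (_ : 0 <= l^-1)) ?invr_ge0 ?(ltW l0) //.
    have : l^-1 * enorm (gh zz - gh zs) <= 2 * enorm (zz - zs).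
      rewrite ler_pdivrMl // (le_trans (hlip _ _)) // mulrA ler_wpM2r ?enorm_ge0 //.
      by lra.
    by lra.
  apply: (@le_trans _ _ ((4 * enorm (z t0.+1 - zs)) ^+ 2)).
    by rewrite ler_pXn2r ?nnegrE ?mulr_ge0 ?enorm_ge0.
  rewrite exprMn enorm_sqr.
  have h3 : dot (z t0.+1 - zs) (z t0.+1 - zs) <= 2 / m * (tau / (64 * (l / m) ^+ 3)).
    by rewrite -[2 / m]invf_div ler_pdivlMl ?divr_gt0 //; lra.
  apply: le_trans (ler_wpM2l _ h3) _; first by lra.
  by rewrite le_eqVlt; apply/orP; left; apply/eqP; field; lra.
exists out, N; split=> //; first by rewrite outE; exact: proj_in.
rewrite ghE in outE hu.
have := @stationary_residual _ _ Z bZ m l^-1 (gh u) (gh out) (gh zs) u zs.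
rewrite /= -outE invrK invr_gt0 => /(_ l0 stat).
have mono : m * dot (out - zs) (out - zs) <= dot (gh out - gh zs) (out - zs).
  have := hlow out zs; have := hlow zs out.
  have -> : zs - out = - (out - zs) by rewrite opprB.
  by rewrite !dotNr !dotNl !dotDl !dotNl !opprK; lra.
move=> /(_ mono) h1.
have h2 : m * enorm (out - zs) <= 3 * l * enorm (u - out).
  have := hlip u out; rewrite (enormB out u) => h2.
  have := enorm_ge0 (u - out); nra.
have h3 : enorm (out - zs) <= 3 * (l / m) * enorm (u - out).
  have -> : 3 * (l / m) * enorm (u - out) = m^-1 * (3 * l * enorm (u - out)).
    by field; lra.
  by rewrite ler_pdivlMl.
rewrite -outE in hu.
have {}hu := le_trans hu thr_le.
apply: (@le_trans _ _ ((3 * (l / m) * enorm (u - out)) ^+ 2)).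
  have k3 : 0 <= 3 * (l / m) by rewrite mulr_ge0 // ltW.
  by rewrite ler_pXn2r ?nnegrE ?enorm_ge0 // mulr_ge0 ?enorm_ge0.
rewrite exprMn; apply: le_trans (ler_wpM2l (sqr_ge0 _) hu) _.
by rewrite le_eqVlt; apply/orP; left; apply/eqP; field; lra.
Qed.

End gradient_descent.

(** * The dual ascent procedure *)

Section maximin.
Context {R : realType} {m n : nat}.
Context (X : set 'rV[R]_m) (Y : set 'rV[R]_n).
Context (G : 'rV[R]_m -> 'rV[R]_n -> R).
Context (Gx : 'rV[R]_m -> 'rV[R]_n -> 'rV[R]_m).
Context (Gy : 'rV[R]_m -> 'rV[R]_n -> 'rV[R]_n).

Lemma sf_grady (l s v : R) x y : 0 < l -> 0 <= v -> saddle_fun l s v X Y G Gx Gy ->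
  grad (G x) y = Gy x y.
Proof.
move=> l0 v0 hG; have hq := sf_grad_x l0 v0 (saddle_fun_swap hG) x.
have : quad_grad setT (G x) (Gy x) ((l + v) / 2).
  move=> z z' _ _; have := hq z z' I I; rewrite dotNl -normrN.
  by congr (`|_| <= _); ring.
exact: quad_grad_grad.
Qed.

Lemma sf_lip_y (l s v : R) x x' y y' : 0 < l -> 0 <= v -> saddle_fun l s v X Y G Gx Gy ->
  enorm (Gy x' y' - Gy x y) <= l * enorm (x' - x) + (l + v) * enorm (y' - y).
Proof.
move=> l0 v0 hG; have := sf_lip_x l0 v0 (saddle_fun_swap hG) y y' x x'.
by rewrite -opprD enormN => h; lra.
Qed.

Lemma sf_stationary_unique (l s v : R) x x' y : 0 < l -> 0 < s ->
  saddle_fun l s v X Y G Gx Gy -> Y y ->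
  stationary X (Gx x y) x -> stationary X (Gx x' y) x' -> x = x'.
Proof.
move=> l0 s0 hG Yy hx hx'.
have := sf_stationary_lipschitz l0 (ltW s0) hG Yy Yy hx hx'.
rewrite subrr enorm0 mulr0 pmulr_rle0 // => h.
apply/esym/eqP; rewrite -subr_eq0 -dot_eq0 -enorm_sqr.
by rewrite sqrf_eq0 eq_le h enorm_ge0.
Qed.

(** The step is (1 - t s) (x - x') minus t times the variation of the smooth
    part, with t s between 2 / 3 and 1 and t l = 1 / 3; hence y need not be in Y. *)
Lemma sf_step_contract (l s v : R) y : 0 < l -> 2 * l <= s -> s <= 3 * l ->
  saddle_fun l s v X Y G Gx Gy -> body X ->
  forall x x', enorm (proj X (x - (3 * l)^-1 *: Gx x y) - proj X (x' - (3 * l)^-1 *: Gx x' y))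
    <= 2 / 3 * enorm (x - x').
Proof.
move=> l0 s2 s3 hG bX x x'; apply: le_trans (proj_lipschitz _ _ bX) _.
set t := (3 * l)^-1.
have t0 : 0 < t by rewrite invr_gt0; lra.
have tl : t * l = 3^-1 by rewrite /t; field; lra.
have -> : x - t *: Gx x y - (x' - t *: Gx x' y) =
    (1 - t * s) *: (x - x') - t *: (Gx x y - Gx x' y - s *: (x - x')).
  by apply/rowP => i; rewrite !mxE; ring.
apply: le_trans (ler_enormB _ _) _; rewrite !enormZ (ger0_norm (ltW t0)).
have ts : t * (2 * l) <= t * s by rewrite ler_wpM2l // ltW.
have ts' : t * s <= t * (3 * l) by rewrite ler_wpM2l // ltW.
rewrite ger0_norm; last by lra.
have h1 := ler_wpM2l (ltW t0) (sf_lip_x_resid l0 hG x' x y).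
rewrite mulrA tl in h1.
have h2 : 2 / 3 * enorm (x - x') <= t * s * enorm (x - x').
  by rewrite ler_wpM2r ?enorm_ge0 //; lra.
lra.
Qed.

(** The gradient of the dual function at an extrapolated point is known up to
    an error of order the inner accuracy; half of the strong concavity absorbs
    it, which leaves a perturbation quadratic in that accuracy. *)
Lemma sf_dual_ascent_step (l s v e : R) x xw w xy y :
  0 < l -> l <= s -> 0 < v -> v <= l -> saddle_fun l s v X Y G Gx Gy ->
  body Y -> X x -> stationary X (Gx xw w) xw -> enorm (x - xw) ^+ 2 <= e ->
  Y y -> stationary X (Gx xy y) xy ->
  let y' := proj Y (w + (9 * l)^-1 *: Gy x w) in
  forall x', stationary X (Gx x' y') x' ->
  - G x' y' + 9 * l / 2 * dot (w - y') (w - y') + 9 * l * dot (w - y') (y - w)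
    + v / 8 / 2 * dot (y - w) (y - w) - 2 * l ^+ 2 * e / v <= - G xy y.
Proof.
move=> l0 ls v0 vl hG bY Xx hxw he Yy hxy y' x' hx'.
have s0 : 0 <= s by lra.
have Yy' : Y y' by exact: proj_in.
have h1 := sf_dual_upper s0 hG w (proj1 hxw) Yy hxy.
have h2 := sf_dual_lower_weak hG y' ls hxw (proj1 hx').
have h3 : dot (Gy x w) (y - y') <= - (9 * l) * dot (w - y') (y - y').
  have := proj_obtuse (w + (9 * l)^-1 *: Gy x w) bY Yy; rewrite -/y'.
  rewrite [w + _ - y']addrAC [dot (_ + _ *: _) _]dotDl dotZl.
  rewrite -lerBrDl sub0r mulrC ler_pdivrMr; last by lra.
  by lra.
have h4 : dot (Gy xw w - Gy x w) (y - y') <=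
    v / 4 * dot (y - w) (y - w) + v / 4 * dot (w - y') (w - y') + 2 * l ^+ 2 * e / v.
  rewrite dotC; have v4 : 0 < v / 4 by lra.
  apply: le_trans (dot_young _ _ v4) _.
  have g1 : dot (Gy xw w - Gy x w) (Gy xw w - Gy x w) <= l ^+ 2 * e.
    apply: (@le_trans _ _ ((l * enorm (x - xw)) ^+ 2)).
      rewrite -enorm_le_sqr ?mulr_ge0 ?enorm_ge0 ?(ltW l0) //.
      have := sf_lip_y x xw w w l0 (ltW v0) hG; rewrite subrr enorm0 mulr0 addr0.
      by rewrite (enormB xw).
    by rewrite exprMn ler_wpM2l ?sqr_ge0.
  have -> : (2 * (v / 4))^-1 = 2 / v by field; lra.
  have g2 := ler_wpM2l (_ : 0 <= 2 / v) g1; have {}g2 := g2 (ltW (divr_gt0 (ltr0Sn _ 1) v0)).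
  have g3 : dot (y - y') (y - y') <= 2 * dot (y - w) (y - w) + 2 * dot (w - y') (w - y').
    have := dot_ge0 ((y - w) - (w - y')).
    by rewrite -(subrKA w y) !dotE (dotC y' w) (dotC y w) (dotC y' y); lra.
  have := ler_wpM2l (ltW v4) g3; lra.
have h5 : dot (Gy xw w) (y - w) - dot (Gy xw w) (y' - w) =
    dot (Gy xw w - Gy x w) (y - y') + dot (Gy x w) (y - y').
  by rewrite !dotE; ring.
have h6 : dot (w - y') (y - y') = dot (w - y') (y - w) + dot (w - y') (w - y').
  by rewrite -dotDr subrKA.
have h7 : dot (y' - w) (y' - w) = dot (w - y') (w - y').
  by rewrite -(opprB w) dotNl dotNr opprK.
rewrite h7 in h2; rewrite h6 in h3.
have h8 : v * dot (w - y') (w - y') <= l * dot (w - y') (w - y').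
  by rewrite ler_wpM2r ?dot_ge0.
have h9 := mulr_ge0 (ltW l0) (dot_ge0 (w - y')).
have h10 := mulr_ge0 (ltW v0) (dot_ge0 (y - w)).
lra.
Qed.

(** Near the saddle point the stopping test succeeds. *)
Lemma sf_residual_upper (l s v e : R) x xw y xh yh :
  0 < l -> l <= s -> 0 < v -> v <= l -> saddle_fun l s v X Y G Gx Gy -> body Y ->
  Y y -> stationary X (Gx xw y) xw -> enorm (x - xw) ^+ 2 <= e ->
  stationary X (Gx xh yh) xh -> stationary Y (- Gy xh yh) yh ->
  enorm (y - proj Y (y + (9 * l)^-1 *: Gy x y)) ^+ 2 <= 18 * enorm (y - yh) ^+ 2 + 2 * e.
Proof.
move=> l0 ls v0 vl hG bY Yy hxw he hxh hyh.
set t := (9 * l)^-1; have t0 : 0 < t by rewrite invr_gt0; lra.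
have tl : t * l = 9^-1 by rewrite /t; field; lra.
have fixy : proj Y (yh + t *: Gy xh yh) = yh.
  by have := stationary_proj bY (ltW t0) hyh; rewrite scalerN opprK.
have hlip : l * enorm (xw - xh) <= l * enorm (y - yh).
  apply: le_trans (_ : _ <= s * enorm (xw - xh)) _; first by rewrite ler_wpM2r ?enorm_ge0.
  by apply: (sf_stationary_lipschitz l0 _ hG (proj1 hyh) Yy hxh hxw); lra.
have {}hlip : enorm (xw - xh) <= enorm (y - yh) by rewrite ler_pM2l in hlip.
have hx : enorm (x - xh) <= enorm (x - xw) + enorm (y - yh).
  by apply: le_trans (ler_enorm_sub xw _ _) _; lra.
have hg : enorm (Gy x y - Gy xh yh) <= 3 * l * enorm (y - yh) + l * enorm (x - xw).
  apply: le_trans (sf_lip_y xh x yh y l0 (ltW v0) hG) _.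
  have := ler_wpM2l (ltW l0) hx.
  have := ler_wpM2r (enorm_ge0 (y - yh)) vl; lra.
have hr : enorm (y - proj Y (y + t *: Gy x y)) <= 3 * enorm (y - yh) + enorm (x - xw).
  apply: le_trans (ler_enorm_sub yh _ _) _.
  rewrite (enormB yh).
  have := proj_lipschitz (y + t *: Gy x y) (yh + t *: Gy xh yh) bY; rewrite fixy.
  have -> : y + t *: Gy x y - (yh + t *: Gy xh yh) = (y - yh) + t *: (Gy x y - Gy xh yh).
    by apply/rowP => i; rewrite !mxE; ring.
  have := ler_enormD (y - yh) (t *: (Gy x y - Gy xh yh)).
  rewrite enormZ (ger0_norm (ltW t0)).
  have h1 := ler_wpM2l (ltW t0) hg.
  have h2 : t * (3 * l * enorm (y - yh) + l * enorm (x - xw)) =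
      3 / 9 * enorm (y - yh) + 9^-1 * enorm (x - xw) by rewrite -tl; ring.
  rewrite h2 in h1.
  by have := enorm_ge0 (y - yh); have := enorm_ge0 (x - xw); lra.
apply: (@le_trans _ _ ((3 * enorm (y - yh) + enorm (x - xw)) ^+ 2)).
  rewrite ler_pXn2r ?nnegrE ?enorm_ge0 //.
  by have := enorm_ge0 (y - yh); have := enorm_ge0 (x - xw); lra.
by have := sqr_ge0 (3 * enorm (y - yh) - enorm (x - xw)); lra.
Qed.

(** Conversely, when the stopping test succeeds the point is near the saddle
    point, so that one gradient step in x yields a good output. *)
Lemma sf_ascent_output (l s v p : R) x xw y xh yh :
  0 < l -> l <= s -> s <= 3 * l -> 0 < v -> 4 * v <= l ->
  saddle_fun l s v X Y G Gx Gy -> body X -> body Y ->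
  Y y -> stationary X (Gx xw y) xw ->
  enorm (x - xw) <= p -> enorm (y - proj Y (y + (9 * l)^-1 *: Gy x y)) <= p ->
  stationary X (Gx xh yh) xh -> stationary Y (- Gy xh yh) yh ->
  forall y', Y y' ->
  G (proj X (x - (18 * (l / v) * l)^-1 *: Gx x y)) y'
    <= G xh yh + 20 * (l / v) * l * (59 * (l / v) * p) ^+ 2.
Proof.
move=> l0 ls sl v0 vl hG bX bY Yy hxw hx; set y1 := proj Y _ => hr hxh hyh y' Yy'.
have s0 : 0 <= s by lra.
have p0 : 0 <= p by exact: le_trans (enorm_ge0 _) hx.
have Yy1 : Y y1 by exact: proj_in.
have k4 : 4 <= l / v by rewrite ler_pdivlMr.
have kv : l / v * v = l by rewrite divfK ?gt_eqF.
have lipx x1 w1 x2 w2 : Y w1 -> Y w2 -> stationary X (Gx x1 w1) x1 ->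
    stationary X (Gx x2 w2) x2 -> enorm (x2 - x1) <= enorm (w2 - w1).
  move=> Yw1 Yw2 h1 h2; rewrite -(ler_pM2l l0).
  apply: le_trans (sf_stationary_lipschitz l0 s0 hG Yw1 Yw2 h1 h2).
  by rewrite ler_wpM2r ?enorm_ge0.
have [xw1 hxw1] := sf_argmin_x l0 s0 hG y1 bX.
have hy1 : v * enorm (y1 - yh) <= 13 * l * p.
  have := @stationary_residual _ _ Y bY v (9 * l)^-1 (- Gy x y) (- Gy xw1 y1) (- Gy xh yh) y yh.
  rewrite /= scalerN opprK -/y1 invrK invr_gt0 => /(_ ltac:(lra) hyh).
  have mono := sf_dual_monotone s0 hG (proj1 hyh) Yy1 hxh hxw1.
  have -> : - Gy xw1 y1 - - Gy xh yh = Gy xh yh - Gy xw1 y1 by rewrite opprK addrC.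
  move=> /(_ mono) h1; apply: le_trans h1 _.
  have h2 := sf_lip_y xw1 x y1 y l0 (ltW v0) hG.
  have -> : - Gy xw1 y1 - - Gy x y = Gy x y - Gy xw1 y1 by rewrite opprK addrC.
  have h3 : enorm (x - xw1) <= p + enorm (y - y1).
    apply: le_trans (ler_enorm_sub xw _ _) _.
    by have := lipx _ _ _ _ Yy1 Yy hxw1 hxw; lra.
  have h4 := ler_wpM2l (ltW l0) h3.
  have h5 : (l + v) * enorm (y - y1) <= 2 * l * enorm (y - y1).
    by rewrite ler_wpM2r ?enorm_ge0 //; lra.
  have h6 := ler_wpM2l (ltW l0) hr.
  by lra.
have {}hy1 : enorm (y1 - yh) <= 13 * (l / v) * p.
  have -> : 13 * (l / v) * p = v^-1 * (13 * l * p) by ring.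
  by rewrite ler_pdivlMl.
have kp : 4 * p <= l / v * p by rewrite ler_wpM2r.
have hb : enorm (y - yh) <= 14 * (l / v) * p.
  by apply: le_trans (ler_enorm_sub y1 _ _) _; lra.
have ha : enorm (x - xh) <= 15 * (l / v) * p.
  apply: le_trans (ler_enorm_sub xw _ _) _.
  by have := lipx _ _ _ _ (proj1 hyh) Yy hxh hxw; lra.
have := sf_saddle_step l0 s0 v0 hG sl vl _ _ bX hxh hyh ha hb Yy'.
move=> /(_ 18 ltac:(lra) ltac:(lra)).
by have -> : 3 * (15 * (l / v) * p) + 14 * (l / v) * p = 59 * (l / v) * p by ring.
Qed.

(** B / 3 is the threshold of the stopping test. The inner error e and the effect
    of the perturbation 2 l^2 e / v accumulated over the steps are small enough
    for the test to succeed; when it does, sf_ascent_output bounds the error of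
    the output by tau / 100. *)
Lemma ascent_tolerances (l v tau : R) :
  0 < l -> 0 < v -> 100 * (10 * v) <= l -> 0 < tau ->
  let k := l / v in let K := 45 * k in let B := tau / (K ^+ 4 * l) in
  let e := tau / K ^+ 7 / l in
  [/\ e <= B / 50,
      4 * Num.sqrt (72 * k) * (2 * l ^+ 2 * e / v) <= v / 2 * (B / 225),
      tau / (10 * K ^+ 5) = v / 2 * (B / 225),
      tau / (K ^+ 4 * (3 * l)) = B / 3 &
      20 * k * l * ((59 * k) ^+ 2 * (B / 3)) <= tau / 100].
Proof.
move=> l0 v0 vl tau0 k K B e.
have k_big : 100 * 10 <= k by rewrite ler_pdivlMr //; lra.
have k0 : 0 < k by rewrite divr_gt0.
have K0 : 0 < K by rewrite mulr_gt0.
have K100 : 100 <= K by rewrite /K; lra.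
have Kn j : 0 < K ^+ j by rewrite exprn_gt0.
have B0 : 0 < B by exact: divr_gt0 tau0 (mulr_gt0 (Kn 4) l0).
have Q0 : 0 <= Num.sqrt (72 * k) by exact: sqrtr_ge0.
have QK : Num.sqrt (72 * k) <= K / 2.
  rewrite -(ler_pXn2r (_ : (0 < 2)%N)) ?nnegrE ?divr_ge0 ?(ltW K0) // sqr_sqrtr; last by lra.
  by have := ler_wpM2l (ltW K0) K100; rewrite /K; lra.
have thr5 : tau / (10 * K ^+ 5) = v / 2 * (B / 225).
  by rewrite /B /K /k; field; rewrite ?gt_eqF.
split=> //.
- have -> : e = B / K ^+ 3 by rewrite /e /B; field; rewrite ?gt_eqF.
  apply: ler_wpdiv2l; [exact: ltW | lra |].
  have : 100 * 1 <= K * K ^+ 2 by rewrite ler_pM // expr2; nra.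
  by rewrite -exprS; lra.
- rewrite -thr5.
  have -> : 4 * Num.sqrt (72 * k) * (2 * l ^+ 2 * e / v) =
      Num.sqrt (72 * k) * (8 / 45 * (tau / K ^+ 6)).
    rewrite /e -[LHS]mulrA; have -> : v = 45 * l / K by rewrite /K /k; field; rewrite ?gt_eqF.
    by field; rewrite ?gt_eqF.
  have t6 : 0 <= 8 / 45 * (tau / K ^+ 6).
    by rewrite mulr_ge0 ?divr_ge0 ?(ltW tau0) ?(ltW (Kn 6)) //; lra.
  apply: le_trans (ler_wpM2r t6 QK) _.
  have -> : K / 2 * (8 / 45 * (tau / K ^+ 6)) = 4 / 45 * (tau / K ^+ 5).
    by field; rewrite ?gt_eqF.
  have -> : tau / (10 * K ^+ 5) = 10^-1 * (tau / K ^+ 5) by field; rewrite ?gt_eqF.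
  by rewrite ler_wpM2r ?divr_ge0 ?(ltW tau0) ?(ltW (Kn 5)) //; lra.
- by rewrite /B; field; rewrite ?gt_eqF.
- have -> : 20 * k * l * ((59 * k) ^+ 2 * (B / 3)) =
      20 * 59 ^+ 2 / 3 * (k ^+ 3 / K ^+ 4) * tau.
    by rewrite /B; field; rewrite ?gt_eqF.
  rewrite (mulrC tau) ler_wpM2r ?(ltW tau0) //.
  rewrite mulrA ler_pdivrMr // /K.
  have k3 : 0 <= k ^+ 3 by rewrite exprn_ge0 // ltW.
  by have : (100 * 10) * k ^+ 3 <= k * k ^+ 3 by [rewrite ler_wpM2r]; lra.
Qed.

(** Acceleration with L = 9 l and m = v / 8, the values encoded in the step and
    in the momentum of the procedure. The powers of K are those of its
    tolerances. *)
Lemma Maximin_AG2_exists (l s v tau Dx Dy : R) x0 y0 xh yh t1 t2 :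
  0 < l -> 2 * l <= s -> s <= 3 * l -> 0 < v -> 100 * (10 * v) <= l ->
  saddle_fun l s v X Y G Gx Gy -> body X -> body Y ->
  (forall x x', X x -> X x' -> enorm (x - x') <= Dx) ->
  (forall y y', Y y -> Y y' -> enorm (y - y') <= Dy) -> X x0 -> Y y0 ->
  stationary X (Gx xh yh) xh -> stationary Y (- Gy xh yh) yh -> 0 < tau ->
  let K := 45 * (l / v) in let e := tau / K ^+ 7 / l in
  (1 <= t1)%N -> (9 / 10) ^+ t1 * (5 / 3 * Dx) <= Num.sqrt (2 / 9 * e) ->
  (1 - (2 * Num.sqrt (72 * (l / v)))^-1) ^+ t2 * (27 * l * Dy ^+ 2 + 2 * l ^+ 2 * e / v)
    <= tau / (10 * K ^+ 5) ->
  exists out N, [/\ Maximin_AG2 X Y G x0 y0 (3 * l) (2 * l) v tau out N, X out,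
    forall y, Y y -> G out y <= G xh yh + tau / 100 &
    (N <= t2.+1 * (4 * t1 + 2) + 1)%N].
Proof.
move=> l0 s2 s3 v0 vl hG bX bY dX dY Xx0 Yy0 hxh hyh tau0 K e t1_gt0 ht1 ht2.
have ls : l <= s by lra.
have s0 : 0 <= s by lra.
have s_gt0 : 0 < s by lra.
have k1000 : 100 * 10 <= l / v by rewrite ler_pdivlMr //; lra.
have kv : l / v * v = l by rewrite divfK ?gt_eqF.
have K0 : 0 < K by rewrite /K; lra.
have Kn j : 0 < K ^+ j by rewrite exprn_gt0.
have e0 : 0 < e by rewrite /e !divr_gt0.
set Q := Num.sqrt (72 * (l / v)) in ht2.
have Q0 : 0 <= Q by exact: sqrtr_ge0.
have Q2 : Q ^+ 2 = 72 * (l / v) by rewrite sqr_sqrtr; lra.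
have Q100 : 100 <= Q by rewrite -(ler_pXn2r (_ : (0 < 2)%N)) ?nnegrE // Q2; lra.
have vQ : v / 8 * Q ^+ 2 = 9 * l by rewrite Q2; lra.
have hK : 10 * (3 * l / (2 * l)) * (3 * l / v) = K.
  by rewrite /K; field; rewrite ?gt_eqF.
have hQ : 4 * Num.sqrt (3 * l / (2 * l) * (3 * l / v)) = Q.
  have -> : 4 = Num.sqrt (4 ^+ 2) :> R by rewrite sqrtr_sqr ger0_norm.
  by rewrite -sqrtrM ?sqr_ge0 //; congr Num.sqrt; field; rewrite ?gt_eqF.
have heta : 2 * (3 * l / (2 * l)) * (3 * l) = 9 * l by field; rewrite gt_eqF.
have hlast : 2 * (3 * l / v) * (3 * l) = 18 * (l / v) * l by field; rewrite gt_eqF.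
have [xs hxs] := choice (fun y => sf_argmin_x l0 s0 hG y bX).
have inner y : exists p : 'rV[R]_m * nat,
    [/\ AGD (fun u => G u y) X x0 (3 * l) (2 * l) (tau / K ^+ 7) p.1 p.2, X p.1,
        enorm (p.1 - xs y) ^+ 2 <= e & (p.2 <= 2 * t1)%N].
  have [out [N [h1 h2 h3 h4]]] : exists out N, [/\
      AGD (fun u => G u y) X x0 (3 * l) (2 * l) (tau / K ^+ 7) out N, X out,
      enorm (out - xs y) ^+ 2 <= e & (N <= 2 * t1)%N].
    apply: (AGD_contractive (D := Dx)) => //.
    - exact: (proj1 (hxs y)).
    - move=> w w'; rewrite !(sf_gradx l0 s0 hG y).
      exact: sf_step_contract l0 s2 s3 hG bX w w'.
    - rewrite (sf_gradx l0 s0 hG y) stationary_proj //.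
      by rewrite invr_ge0; lra.
    - by rewrite divr_ge0 // ltW.
  by exists (out, N).
have [po hpo] := choice inner.
pose xo y := (po y).1; pose no y := (po y).2.
pose stepy y := proj Y (y + (9 * l)^-1 *: grad (G (xo y)) y).
pose theta := (Q - 1) / (Q + 1).
have [y [yt [y_0 yt_0 hy hyt]]] : exists y yt : nat -> 'rV[R]_n,
    [/\ y 0%N = y0, yt 0%N = y0, forall j, y j.+1 = stepy (yt j) &
     forall j, yt j.+1 = y j.+1 + theta *: (y j.+1 - y j)].
  pose next (p : 'rV[R]_n * 'rV[R]_n) :=
    (stepy p.2, stepy p.2 + theta *: (stepy p.2 - p.1)).
  by exists (fun j => (iter j next (y0, y0)).1), (fun j => (iter j next (y0, y0)).2).
have Yy j : Y (y j) by case: j => [|j]; rewrite ?y_0 // hy; exact: proj_in.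
have gE a b : grad (G a) b = Gy a b by exact: sf_grady l0 (ltW v0) hG.
have xsh : xs yh = xh.
  exact: sf_stationary_unique l0 s_gt0 hG (proj1 hyh) (hxs yh) hxh.
have strong y' : Y y' -> - G (xs yh) yh + v / 2 * dot (y' - yh) (y' - yh) <= - G (xs y') y'.
  move=> Yy'; have := sf_dual_upper s0 hG yh (proj1 hxh) Yy' (hxs y').
  by have := proj2 hyh _ Yy'; rewrite dotNl xsh; lra.
set del := 2 * l ^+ 2 * e / v in ht2.
have del0 : 0 <= del.
  by rewrite divr_ge0 ?(ltW v0) // mulr_ge0 ?(ltW e0) // mulr_ge0 ?sqr_ge0.
have mA : v / 8 * (Q ^+ 2 - 1) <= 9 * l by rewrite mulrBr vQ; lra.
have v8 : 0 < v / 8 by lra.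
have strong8 y' : Y y' ->
    - G (xs yh) yh + v / 8 / 2 * dot (y' - yh) (y' - yh) <= - G (xs y') y'.
  move=> Yy'; have := strong y' Yy'.
  by have := mulr_ge0 (ltW v0) (dot_ge0 (y' - yh)); lra.
have hstep j y' : Y y' ->
    - G (xs (y j.+1)) (y j.+1) + 9 * l / 2 * dot (yt j - y j.+1) (yt j - y j.+1)
    + v / 8 * Q ^+ 2 * dot (yt j - y j.+1) (y' - yt j)
    + v / 8 / 2 * dot (y' - yt j) (y' - yt j) - del <= - G (xs y') y'.
  move=> Yy'; rewrite vQ hy /stepy gE.
  have [_ Xxo xoe _] := hpo (yt j).
  have vl' : v <= l by lra.
  exact: (sf_dual_ascent_step l0 ls v0 vl' hG bY Xxo (hxs (yt j)) xoe Yy' (hxs y') (hxs _)).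
have hV := accel_rate v8 Q100 mA del0 dY (proj1 hyh) Yy (etrans yt_0 (esym y_0)) hyt
  strong8 hstep t2.
rewrite vQ mulrA [3 * 9](_ : _ = 27) in hV; last by ring.
pose B := tau / (K ^+ 4 * l).
have B0 : 0 < B by exact: divr_gt0 tau0 (mulr_gt0 (Kn 4) l0).
have [eB hdel thr5 thrE last_step] := ascent_tolerances l0 v0 vl tau0.
rewrite -/K -/B -/e -/Q -/del in eB hdel thr5 thrE last_step.
have hd : enorm (y t2.+1 - yh) ^+ 2 <= B / 100.
  rewrite enorm_sqr; have := strong _ (Yy t2.+1).
  rewrite thr5 in ht2; move=> h; have : v / 2 * dot (y t2.+1 - yh) (y t2.+1 - yh) <= v / 2 * (B / 100) by nra.
  by rewrite ler_pM2l //; lra.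
pose stop j : Prop := enorm (y j - proj Y (y j
     + (9 * l)^-1 *: grad (G (xo (y j))) (y j))) ^+ 2 <= tau / (K ^+ 4 * (3 * l)).
have st2 : stop t2.+1.
  rewrite /stop thrE gE; have vl' : v <= l by lra.
  have [_ _ xoe _] := hpo (y t2.+1).
  have := sf_residual_upper l0 ls v0 vl' hG bY (Yy t2.+1) (hxs _) xoe hxh hyh.
  by lra.
have [t ft tt2] := first_stop_exists (ltn0Sn t2) st2.
have [_ Xxt xte _] := hpo (y t).
exists (proj X (xo (y t) - (18 * (l / v) * l)^-1 *: grad (fun u => G u (y t)) (xo (y t)))).
exists (\sum_(j < t) (no (yt j) + no (y j.+1) + 2) + 1)%N; split.
- rewrite /Maximin_AG2; cbv zeta; rewrite hK hQ heta hlast.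
  exists (fun j => xo (y j)), (fun j => xo (yt j)), y, yt, (fun j => no (yt j)), (fun j => no (y j)), t.
  split=> // j _; split; [by case: (hpo (yt j)) | exact: hy | exact: hyt |].
  by case: (hpo (y j.+1)).
- exact: proj_in.
- move=> y' Yy'; rewrite (sf_gradx l0 s0 hG).
  have [_ stt _] := ft; rewrite /stop thrE gE in stt; clear ft st2.
  have p0 : 0 <= B / 3 by lra.
  have hx1 : enorm (xo (y t) - xs (y t)) <= Num.sqrt (B / 3).
    rewrite enorm_le_sqr ?sqrtr_ge0 // -enorm_sqr (sqr_sqrtr p0).
    by apply: le_trans xte _; lra.
  have hr : enorm (y t - proj Y (y t + (9 * l)^-1 *: Gy (xo (y t)) (y t))) <= Num.sqrt (B / 3).
    by rewrite enorm_le_sqr ?sqrtr_ge0 // -enorm_sqr (sqr_sqrtr p0).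
  have vl' : 4 * v <= l by lra.
  have := sf_ascent_output l0 ls s3 v0 vl' hG bX bY (Yy t) (hxs _) hx1 hr hxh hyh Yy'.
  by rewrite exprMn (sqr_sqrtr p0) => h; apply: le_trans h _; rewrite lerD2l.
rewrite leq_add2r (leq_trans (n := t * (4 * t1 + 2))) //; last by rewrite leq_mul2r tt2 orbT.
rewrite -[t in (t * _)%N]card_ord -sum_nat_const; apply: leq_sum => j _.
have [_ _ _ n1] := hpo (yt j); have [_ _ _ n2] := hpo (y j.+1).
rewrite leq_add2r (leq_trans (leq_add n1 n2)) // -mulnDr addnn -mul2n mulnA //.
Qed.

End maximin.

(** * The accelerated proximal point method *)

Section minimax.
Context {R : realType} {m n : nat}.
Context (X : set 'rV[R]_m) (Y : set 'rV[R]_n).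
Context (F : 'rV[R]_m -> 'rV[R]_n -> R).
Context (Fx : 'rV[R]_m -> 'rV[R]_n -> 'rV[R]_m).
Context (Fy : 'rV[R]_m -> 'rV[R]_n -> 'rV[R]_n).

Lemma sf_argmax_y (l s v : R) : 0 < l -> 0 <= v -> saddle_fun l s v X Y F Fx Fy ->
  body Y -> exists ys, forall x, stationary Y (- Fy x (ys x)) (ys x).
Proof.
move=> l0 v0 hF bY.
by have [ys hys] := choice (fun x => sf_argmin_x l0 v0 (saddle_fun_swap hF) x bY); exists ys.
Qed.

Lemma sf_stationary_max (l s v : R) x y y' : saddle_fun l s v X Y F Fx Fy -> X x ->
  stationary Y (- Fy x y) y -> Y y' ->
  F x y' + v / 2 * dot (y' - y) (y' - y) <= F x y.
Proof.
move=> hF Xx hy Yy'.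
by have := sf_stationary_min (saddle_fun_swap hF) Xx hy Yy'; lra.
Qed.

(** A point minimizing the proximal problem up to tau behaves, for the primal
    function F x (ys x), as an accelerated step with a perturbation of order
    l / s * tau: replacing the exact minimizer by an approximate one costs a
    fraction of the strong convexity. *)
Lemma prox_step (l s v tau : R) ys (w out x : 'rV[R]_m) xh yh :
  0 < l -> 0 < s -> 100 * s <= l -> 0 <= v -> 0 <= tau ->
  saddle_fun l s v X Y F Fx Fy ->
  (forall x, stationary Y (- Fy x (ys x)) (ys x)) ->
  stationary X (Fx xh yh + (2 * l) *: (xh - w)) xh -> Y yh ->
  X out -> X x ->
  (forall y, Y y -> F out y + l * enorm (out - w) ^+ 2
     <= F xh yh + l * enorm (xh - w) ^+ 2 + tau / 100) ->
  F out (ys out) + 2 * l / 2 * dot (w - out) (w - out) + 2 * l * dot (w - out) (x - w)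
    + s / 2 / 2 * dot (x - w) (x - w) - 2 * (l / s) * tau <= F x (ys x).
Proof.
move=> l0 s0 sl v0 tau0 hF hys hxh Yyh Xout Xx hout.
have hG := saddle_fun_prox (2 * l) w hF.
have min x' : X x' -> F xh yh + l * enorm (xh - w) ^+ 2
    + (s + 2 * l) / 2 * dot (x' - xh) (x' - xh) <= F x' yh + l * enorm (x' - w) ^+ 2.
  move=> Xx'; have := sf_stationary_min hG Yyh hxh Xx'.
  have -> : 2 * l / 2 = l by field.
  by [].
have h1 := hout _ (proj1 (hys out)).
have h2 := sf_stationary_max hF Xx (hys x) Yyh.
have h2' := mulr_ge0 v0 (dot_ge0 (yh - ys x)).
have h3 := min _ Xx; have h4 := min _ Xout; have h5 := hout _ Yyh.
have h6 : dot (out - xh) (out - xh) <= tau / (100 * l).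
  rewrite ler_pdivlMr ?mulr_gt0 //.
  have := mulr_ge0 (ltW s0) (dot_ge0 (out - xh)); lra.
(* the relative weight of the error out - xh against x - out, chosen so that only
   a fraction of the strong convexity s is lost *)
pose sg := s / (16 * l).
have sg0 : 0 < sg by rewrite divr_gt0 ?mulr_gt0.
have h7 := dot_young (- (x - out)) (out - xh) sg0.
have h8 : dot (x - xh) (x - xh) = dot (x - out) (x - out) + 2 * dot (x - out) (out - xh)
    + dot (out - xh) (out - xh).
  have -> : x - xh = (x - out) + (out - xh) by rewrite subrKA.
  by move: (x - out) (out - xh) => p r; rewrite !dotDl !dotDr (dotC r p); ring.
have {h7 h8} h8 : (1 - sg) * dot (x - out) (x - out) - sg^-1 * dot (out - xh) (out - xh)
    <= dot (x - xh) (x - xh).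
  move: h7; rewrite dotNl dotNl dotNr opprK invfM => h7.
  by have := dot_ge0 (out - xh); lra.
have sl0 : 0 <= (s + 2 * l) / 2 by lra.
have {}h8 := ler_wpM2l sl0 h8.
have h9 : (s + 2 * l) / 2 * sg <= s / 15.
  rewrite /sg mulrA ler_pdivrMr ?mulr_gt0 //.
  by have := ler_wpM2l (ltW s0) sl; have := mulr_ge0 (ltW s0) (ltW l0); lra.
have h10 : (s + 2 * l) / 2 * (sg^-1 * dot (out - xh) (out - xh)) <= l / s * tau.
  have i0 : 0 <= sg^-1 by rewrite invr_ge0 ltW.
  apply: le_trans (ler_wpM2l sl0 (ler_wpM2l i0 h6)) _.
  have -> : (s + 2 * l) / 2 * (sg^-1 * (tau / (100 * l))) = (s + 2 * l) * (8 / 100 / s * tau).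
    by rewrite /sg; field; rewrite ?gt_eqF.
  have -> : l / s * tau = (100 / 8 * l) * (8 / 100 / s * tau) by field; rewrite gt_eqF.
  rewrite ler_wpM2r; [by [] | | lra].
  by rewrite mulr_ge0 // divr_ge0 ?(ltW s0) //; lra.
have h11 := ler_wpM2r (dot_ge0 (x - out)) h9.
have tk : tau <= l / s * tau.
  by rewrite -[leLHS]mul1r ler_wpM2r // ler_pdivlMr //; lra.
have e1 : x - out = (x - w) + (w - out) by rewrite subrKA.
have e2 : dot (out - w) (out - w) = dot (w - out) (w - out).
  by rewrite -(opprB w) dotNl dotNr opprK.
rewrite !enorm_sqr e2 in h1; rewrite !enorm_sqr in h3.
have h13 := ler_wpM2r (dot_ge0 (w - out)) sl.
rewrite e1 in h8 h11; move: (x - w) (w - out) h1 h2 h3 h8 h11 h13 => p d h1 h2 h3 h8 h11 h13.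
(* passing from the distance to out to the distance to w costs a multiple of
   s |d|^2, absorbed by l |d|^2 *)
have h12 := mulr_ge0 (ltW s0) (dot_ge0 (p + 4 *: d)).
have h14 := mulr_ge0 (ltW s0) (dot_ge0 p).
have h15 := mulr_ge0 (ltW s0) (dot_ge0 d).
have e3 : dot (p + d) (p + d) = dot p p + 2 * dot d p + dot d d.
  by rewrite !dotE (dotC p d); ring.
rewrite e3 in h8 h11; move: h12; rewrite !dotE (dotC p d); lra.
Qed.

(** An almost optimal xT is near the saddle point by strong convexity, hence so
    is the approximate maximizer yt of F xT; the last step turns this
    into a bound on the gap in y. *)
Lemma final_ascent (l s v ep Dy : R) y0 xT xh yh ys t4 :
  0 < l -> 0 < s -> 100 * (100 * s) <= l -> 0 < v -> 100 * (100 * v) <= l -> 0 < ep ->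
  saddle_fun l s v X Y F Fx Fy -> body X -> body Y ->
  (forall y y', Y y -> Y y' -> enorm (y - y') <= Dy) -> Y y0 -> X xT ->
  (forall x, stationary Y (- Fy x (ys x)) (ys x)) ->
  stationary X (Fx xh yh) xh -> stationary Y (- Fy xh yh) yh ->
  F xT (ys xT) - F xh yh <= ep / (10 ^+ 4 * (l / s * (l / v)) ^+ 2) ->
  let ept := ep / (10 ^+ 2 * (l / s) * (l / v)) in
  (1 - (2 * Num.sqrt (l / v))^-1) ^+ t4 * (3 * l * Dy ^+ 2) <= ept / (64 * (l / v) ^+ 3) ->
  exists yt N, [/\ AGD (fun y => - F xT y) Y y0 l v ept yt N, (N <= 2 * t4.+1)%N &
    let yo := proj Y (yt + (2 * (l / s) * l)^-1 *: grad (F xT) yt) in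
    Y yo /\ forall x y, X x -> Y y -> F xT y - F x yo <= ep].
Proof.
move=> l0 s0 sl v0 vl ep0 hF bX bY dY Yy0 XxT hys hxh hyh hgap ept ht4.
have k4 : 100 * 100 <= l / s by rewrite ler_pdivlMr //; lra.
have k4' : 100 * 100 <= l / v by rewrite ler_pdivlMr //; lra.
have k0 : 0 < l / s by rewrite divr_gt0.
have k0' : 0 < l / v by rewrite divr_gt0.
have swF := saddle_fun_swap hF.
have ept0 : 0 <= ept.
  apply: divr_ge0; first exact: ltW.
  by apply: mulr_ge0 (ltW k0'); apply: mulr_ge0 (ltW k0); exact: exprn_ge0.
have e0 : 0 <= ept / l by exact: divr_ge0 ept0 (ltW l0).
have gN w : grad (fun y => - F xT y) w = - Fy xT w.
  exact: sf_gradx l0 (ltW v0) swF xT w.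
have gF w : grad (F xT) w = Fy xT w by exact: sf_grady l0 (ltW v0) hF.
have hup w z : - F xT z <= - F xT w + dot (- Fy xT w) (z - w) + (l + v) / 2 * dot (z - w) (z - w).
  have := sf_expand swF w xT z xT; rewrite subrr !dot0r !mulr0 !(subr0, addr0).
  by rewrite ler_norml => /andP[_]; lra.
have hlow w z : - F xT w + dot (- Fy xT w) (z - w) + v / 2 * dot (z - w) (z - w) <= - F xT z.
  exact: sf_convex swF _ _ _ XxT.
have hlip w z : enorm (- Fy xT z - - Fy xT w) <= (l + v) * enorm (z - w).
  by have := sf_lip_x l0 (ltW v0) swF w z xT xT; rewrite subrr enorm0 mulr0 addr0.
have [yt [N [hA Yyt hyt hN]]] := AGD_accelerated v0 vl bY dY Yy0 gN hup hlow hlip (hys xT) ept0 ht4.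
exists yt, N; split=> //; rewrite gF; set yo := proj Y _.
have Yyo : Y yo by exact: proj_in.
split=> // x y Xx Yy.
have h1 := sf_stationary_max hF XxT (hys xT) Yy.
have h2 := mulr_ge0 (ltW v0) (dot_ge0 (y - ys xT)).
pose k := l / s; pose k' := l / v.
pose V := F xT (ys xT) - F xh yh.
have hb : dot (xT - xh) (xT - xh) <= 2 * k / l * V.
  have g1 := sf_stationary_min hF (proj1 hyh) hxh XxT.
  have g2 := sf_stationary_max hF XxT (hys xT) (proj1 hyh).
  have g3 := mulr_ge0 (ltW v0) (dot_ge0 (yh - ys xT)).
  have -> : 2 * k / l * V = (s / 2)^-1 * V by rewrite /k; field; rewrite ?gt_eqF.
  by rewrite ler_pdivlMl ?divr_gt0 // /V; lra.
pose b := enorm (xT - xh); pose a := 3 * Num.sqrt (ept / l) + k' * b.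
have b0 : 0 <= b by exact: enorm_ge0.
have ha : enorm (yt - yh) <= a.
  apply: le_trans (ler_enorm_sub (ys xT) _ _) _; apply: lerD.
    rewrite enorm_le_sqr ?mulr_ge0 ?sqrtr_ge0 // exprMn (sqr_sqrtr e0).
    by rewrite -enorm_sqr; lra.
  have := sf_stationary_lipschitz l0 (ltW v0) swF (proj1 hxh) XxT hyh (hys xT).
  have -> : k' * b = v^-1 * (l * b) by rewrite /k'; ring.
  by rewrite ler_pdivlMl.
have sv : v <= 3 * l by lra.
have ssl : 4 * s <= l by lra.
have hxh' : stationary X (- - Fx xh yh) xh by rewrite opprK.
have := sf_saddle_step l0 (ltW v0) s0 swF sv ssl (lexx 2) _ bY hyh hxh' ha (lexx b) Xx.
rewrite scalerN opprK -/k -/yo => /(_ ltac:(lra)) h3.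
suff h4 : 20 * k * l * (3 * a + b) ^+ 2 + V <= ep by rewrite /V in h4; lra.
have V0 : 0 <= V.
  have : 0 <= 2 * k / l * V by exact: le_trans (dot_ge0 _) hb.
  by rewrite pmulr_rge0 // divr_gt0 // mulr_gt0.
(* V is far smaller than ept, which compensates for the factor k' ^ 2 *)
have h5 : (3 * a + b) ^+ 2 <= 162 * (ept / l) + 32 * k' ^+ 2 * b ^+ 2.
  apply: (@le_trans _ _ ((9 * Num.sqrt (ept / l) + 4 * (k' * b)) ^+ 2)).
    have bk : 100 * 100 * b <= k' * b by rewrite ler_wpM2r.
    have a0 : 0 <= Num.sqrt (ept / l) by exact: sqrtr_ge0.
    by rewrite ler_pXn2r ?nnegrE /a //; lra.
  rewrite -[ept / l in leRHS](sqr_sqrtr e0).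
  by have := sqr_ge0 (9 * Num.sqrt (ept / l) - 4 * (k' * b)); lra.
have kl0 : 0 <= 20 * k * l by exact: mulr_ge0 (mulr_ge0 (ler0n _ 20) (ltW k0)) (ltW l0).
have := ler_wpM2l kl0 h5; rewrite /b enorm_sqr.
have h6 : 20 * k * l * (162 * (ept / l)) <= ep / 100.
  have -> : 20 * k * l * (162 * (ept / l)) = (20 * 162 / 100 / k') * ep.
    by rewrite /ept /k /k'; field; rewrite ?gt_eqF.
  have -> : ep / 100 = 100^-1 * ep by ring.
  by rewrite ler_wpM2r ?(ltW ep0) // ler_pdivrMr //; rewrite -/k' in k4'; lra.
have h7 : 20 * k * l * (32 * k' ^+ 2 * dot (xT - xh) (xT - xh)) <= ep / 4.
  have kk : 0 <= 20 * k * l * (32 * k' ^+ 2).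
    by rewrite mulr_ge0 // mulr_ge0 // exprn_ge0 // ltW.
  rewrite mulrA; apply: le_trans (ler_wpM2l kk hb) _.
  have -> : 20 * k * l * (32 * k' ^+ 2) * (2 * k / l * V) = 20 * 64 * (k * k') ^+ 2 * V.
    by field; rewrite gt_eqF.
  have kk2 : 0 < (k * k') ^+ 2 by rewrite exprn_gt0 // mulr_gt0.
  have := hgap; rewrite -/V -/k -/k' ler_pdivlMr; last by rewrite mulr_gt0 // exprn_gt0.
  by lra.
have h8 : V <= ep / 4.
  apply: le_trans hgap _; apply: ler_wpdiv2l; [exact: ltW | lra |].
  have : 1 <= (l / s * (l / v)) ^+ 2.
    by apply: exprn_ege1; apply: mulr_ege1; lra.
  by move: (_ ^+ 2) => q q1; lra.
by lra.
Qed.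

(** Acceleration for the primal function F x (ys x), with L = 2 l and m = s / 2:
    half of the strong convexity is spent on the inexactness. *)
Lemma Minimax_APPA_exists (l s v ep Dx Dy : R) x0 y0 t1 t2 t3 t4 :
  0 < l -> 0 < s -> 100 * (100 * s) <= l -> 0 < v -> 100 * (100 * v) <= l -> 0 < ep ->
  saddle_fun l s v X Y F Fx Fy -> body X -> body Y ->
  (forall x x', X x -> X x' -> enorm (x - x') <= Dx) ->
  (forall y y', Y y -> Y y' -> enorm (y - y') <= Dy) -> X x0 -> Y y0 ->
  let k1 := l / s in let k2 := l / v in
  let tau := ep / (10 * k1 * k2) ^+ 4 in let K := 45 * k2 in
  let e := tau / K ^+ 7 / l in
  (1 <= t1)%N -> (9 / 10) ^+ t1 * (5 / 3 * Dx) <= Num.sqrt (2 / 9 * e) ->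
  (1 - (2 * Num.sqrt (72 * k2))^-1) ^+ t2 * (27 * l * Dy ^+ 2 + 2 * l ^+ 2 * e / v)
    <= tau / (10 * K ^+ 5) ->
  (1 - (2 * (2 * Num.sqrt k1))^-1) ^+ t3 * (6 * l * Dx ^+ 2 + 2 * k1 * tau)
    <= ep / (2 * 10 ^+ 4 * (k1 * k2) ^+ 2) ->
  (1 - (2 * Num.sqrt k2)^-1) ^+ t4 * (3 * l * Dy ^+ 2)
    <= ep / (10 ^+ 2 * k1 * k2) / (64 * k2 ^+ 3) ->
  exists xo yo N, [/\ Minimax_APPA X Y F x0 y0 l s v ep t3.+1 xo yo N, X xo, Y yo,
    forall x y, X x -> Y y -> F xo y - F x yo <= ep &
    (N <= t3.+1 * (t2.+1 * (4 * t1 + 2) + 1) + 2 * t4.+1 + 1)%N].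
Proof.
move=> l0 s0 sl v0 vl ep0 hF bX bY dX dY Xx0 Yy0 k1 k2 tau K e t1_gt0 ht1 ht2 ht3 ht4.
have k1_big : 100 * 100 <= k1 by rewrite ler_pdivlMr //; lra.
have k2_big : 100 * 100 <= k2 by rewrite ler_pdivlMr //; lra.
have k1_gt0 : 0 < k1 by rewrite divr_gt0.
have k2_gt0 : 0 < k2 by rewrite divr_gt0.
have tau0 : 0 < tau.
  by apply: divr_gt0 => //; rewrite exprn_gt0 // mulr_gt0 // mulr_gt0.
have [ys hys] := sf_argmax_y l0 (ltW v0) hF bY.
have [xs [yd [hxs hyd]]] := sf_saddle l0 (ltW s0) (ltW v0) hF s0 bX bY.
have inner w : exists p : 'rV[R]_m * nat, [/\
    Maximin_AG2 X Y (fun x y => F x y + l * enorm (x - w) ^+ 2) x0 y0 (3 * l) (2 * l)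
      v tau p.1 p.2, X p.1, (p.2 <= t2.+1 * (4 * t1 + 2) + 1)%N &
    forall x, X x -> F p.1 (ys p.1) + 2 * l / 2 * dot (w - p.1) (w - p.1)
      + s / 2 * (2 * Num.sqrt k1) ^+ 2 * dot (w - p.1) (x - w)
      + s / 2 / 2 * dot (x - w) (x - w) - 2 * k1 * tau <= F x (ys x)].
  have hG := saddle_fun_prox (2 * l) w hF.
  have gE : (fun x y => F x y + 2 * l / 2 * enorm (x - w) ^+ 2) =
      (fun x y => F x y + l * enorm (x - w) ^+ 2).
    apply/funext => x; apply/funext => y.
    by have -> : 2 * l / 2 = l by field.
  rewrite gE in hG.
  have sl_gt0 : 0 < s + 2 * l by lra.
  have [xh [yh [hxh hyh]]] := sf_saddle l0 (ltW sl_gt0) (ltW v0) hG sl_gt0 bX bY.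
  have b1 : 2 * l <= s + 2 * l by lra.
  have b2 : s + 2 * l <= 3 * l by lra.
  have b3 : 100 * (10 * v) <= l by lra.
  have [out [N [hM Xout hq hN]]] := Maximin_AG2_exists l0 b1 b2 v0 b3 hG bX bY dX dY
    Xx0 Yy0 hxh hyh tau0 t1_gt0 ht1 ht2.
  exists (out, N); split=> //= x Xx.
  have -> : s / 2 * (2 * Num.sqrt k1) ^+ 2 = 2 * l.
    by rewrite exprMn sqr_sqrtr ?(ltW k1_gt0) // /k1; field; rewrite gt_eqF.
  have b4 : 100 * s <= l by lra.
  exact: (prox_step l0 s0 b4 (ltW v0) (ltW tau0) hF hys hxh (proj1 hyh) Xout Xx hq).
have [po hpo] := choice inner.
pose theta := (2 * Num.sqrt k1 - 1) / (2 * Num.sqrt k1 + 1).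
have [x [xt [x_0 xt_0 hx hxt]]] : exists x xt : nat -> 'rV[R]_m,
    [/\ x 0%N = x0, xt 0%N = x0, forall j, x j.+1 = (po (xt j)).1 &
     forall j, xt j.+1 = x j.+1 + theta *: (x j.+1 - x j)].
  pose next (p : 'rV[R]_m * 'rV[R]_m) :=
    ((po p.2).1, (po p.2).1 + theta *: ((po p.2).1 - p.1)).
  by exists (fun j => (iter j next (x0, x0)).1), (fun j => (iter j next (x0, x0)).2).
have Xx j : X (x j).
  by case: j => [|j]; rewrite ?x_0 // hx; case: (hpo (xt j)).
have phis : F xs (ys xs) <= F xs yd.
  have := sf_stationary_max hF (proj1 hxs) hyd (proj1 (hys xs)).
  by have := mulr_ge0 (ltW v0) (dot_ge0 (ys xs - yd)); lra.
have strong x' : X x' -> F xs (ys xs) + s / 2 / 2 * dot (x' - xs) (x' - xs) <= F x' (ys x').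
  move=> Xx'; have := sf_stationary_min hF (proj1 hyd) hxs Xx'.
  have := sf_stationary_max hF Xx' (hys x') (proj1 hyd).
  have := mulr_ge0 (ltW v0) (dot_ge0 (yd - ys x')).
  by have := mulr_ge0 (ltW s0) (dot_ge0 (x' - xs)); lra.
have sq0 : 0 <= Num.sqrt k1 by exact: sqrtr_ge0.
have sqE : Num.sqrt k1 ^+ 2 = k1 by rewrite sqr_sqrtr // ltW.
have sq100 : 100 <= Num.sqrt k1.
  by rewrite -(ler_pXn2r (_ : (0 < 2)%N)) ?nnegrE // sqE expr2.
have Q100 : 100 <= 2 * Num.sqrt k1 by lra.
have mQ : s / 2 * (2 * Num.sqrt k1) ^+ 2 = 2 * l.
  by rewrite exprMn sqE /k1; field; rewrite gt_eqF.
have mA : s / 2 * ((2 * Num.sqrt k1) ^+ 2 - 1) <= 2 * l by rewrite mulrBr mQ; lra.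
have s2 : 0 < s / 2 by lra.
have kt0 : 0 <= 2 * k1 * tau by rewrite mulr_ge0 ?(ltW tau0) // mulr_ge0 // ltW.
have hstep j x' : X x' -> F (x j.+1) (ys (x j.+1))
    + 2 * l / 2 * dot (xt j - x j.+1) (xt j - x j.+1)
    + s / 2 * (2 * Num.sqrt k1) ^+ 2 * dot (xt j - x j.+1) (x' - xt j)
    + s / 2 / 2 * dot (x' - xt j) (x' - xt j) - 2 * k1 * tau <= F x' (ys x').
  by move=> Xx'; rewrite hx; have [_ _ _] := hpo (xt j); apply.
have hV := accel_rate s2 Q100 mA kt0 dX (proj1 hxs) Xx (etrans xt_0 (esym x_0)) hxt
  strong hstep t3.
rewrite mQ mulrA [3 * 2](_ : _ = 6) in hV; last by ring.
have hgap : F (x t3.+1) (ys (x t3.+1)) - F xs yd <= ep / (10 ^+ 4 * (k1 * k2) ^+ 2).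
  have kk : 0 < (k1 * k2) ^+ 2 by rewrite exprn_gt0 // mulr_gt0.
  pose u := ep / (10 ^+ 4 * (k1 * k2) ^+ 2).
  have uE : ep / (2 * 10 ^+ 4 * (k1 * k2) ^+ 2) = u / 2.
    by rewrite /u; field; rewrite ?gt_eqF.
  have u0 : 0 <= u by rewrite divr_ge0 ?(ltW ep0) // mulr_ge0 ?(ltW kk) // exprn_ge0.
  have err : 4 * (2 * Num.sqrt k1) * (2 * k1 * tau) <= u / 2.
    have sk : Num.sqrt k1 <= k1 by rewrite -[leRHS]sqE expr2 ler_peMr //; lra.
    have -> : 4 * (2 * Num.sqrt k1) * (2 * k1 * tau) = 16 * k1 * tau * Num.sqrt k1 by ring.
    have h16 : 0 <= 16 * k1 * tau by rewrite mulr_ge0 ?(ltW tau0) // mulr_ge0 // ltW.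
    apply: le_trans (ler_wpM2l h16 sk) _.
    have -> : 16 * k1 * tau * k1 = 16 / k2 ^+ 2 * u.
      by rewrite /tau /u; field; rewrite ?gt_eqF.
    rewrite [u / 2]mulrC ler_wpM2r // ler_pdivrMr ?exprn_gt0 // expr2.
    by have := ler_wpM2l (ltW k2_gt0) k2_big; lra.
  move: hV err ht3; rewrite uE -/u.
  by move: (_ ^+ t3 * _) (4 * _ * _) => q1 q2; lra.
have [yt [N [hA hN [Yyo gap]]]] := final_ascent l0 s0 sl v0 vl ep0 hF bX bY dY Yy0
  (Xx t3.+1) hys hxs hyd hgap ht4.
exists (x t3.+1), (proj Y (yt + (2 * (l / s) * l)^-1 *: grad (F (x t3.+1)) yt)).
exists (\sum_(j < t3.+1) (po (xt j)).2 + N + 1)%N; split=> //.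
  rewrite /Minimax_APPA; cbv zeta.
  exists x, xt, (fun j => (po (xt j.-1)).2), yt, N; split=> //.
  by move=> j _; rewrite /= hxt; split=> //; rewrite hx; case: (hpo (xt j)).
rewrite leq_add2r leq_add //.
rewrite -[t in (t * _)%N]card_ord -sum_nat_const; apply: leq_sum => j _.
by case: (hpo (xt j)).
Qed.

End minimax.

(** * From smoothness and convexity to quadratic expansions *)

Section smooth_convex.
Context {R : realType}.

Lemma row_delta_sum n (d : 'rV[R]_n) : d = \sum_(i < n) d 0 i *: delta_mx 0 i.
Proof. by rewrite [LHS]matrix_sum_delta big_ord1. Qed.

Lemma derive_grad n (h : 'rV[R]_n -> R) z d :
  differentiable h z -> 'D_d h z = dot (grad h z) d.
Proof.
move=> dh; rewrite deriveE // {1}(row_delta_sum d) linear_sum.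
by apply: eq_bigr => i _; rewrite linearZ /= mxE deriveE // mulrC.
Qed.

(** The mean value theorem applied to h along the segment, minus its linear
    part and the quadratic l / 2 t^2. *)
Lemma smooth_upper n (l sg : R) (h : 'rV[R]_n -> R) z z' : smooth l h ->
  `|sg| = 1 ->
  sg * (h z' - h z - dot (grad h z) (z' - z)) <= l / 2 * dot (z' - z) (z' - z).
Proof.
move=> [dh lh] sg1; set d := z' - z.
pose e t := sg * (h (z + t *: d) - t * dot (grad h z) d) - l / 2 * t ^+ 2 * dot d d.
pose e' t := sg * (dot (grad h (z + t *: d)) d - dot (grad h z) d) - l * t * dot d d.
have hline (t : R) : is_derive t (1 : R) (fun t : R => h (z + t *: d)) (dot (grad h (z + t *: d)) d).
  have E : (fun u => u^-1 *: (((fun t => h (z + t *: d)) \o shift t) (u *: (1 : R)) - h (z + t *: d)))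
       = (fun u => u^-1 *: ((h \o shift (z + t *: d)) (u *: d) - h (z + t *: d))).
    apply/funext => u /=; congr (_ *: (h _ - _)).
    by rewrite scalerDl [u *: 1]mulr1 addrCA.
  have dz : derivable h (z + t *: d) d by exact: diff_derivable.
  apply: DeriveDef; first by move: dz; rewrite /derivable E.
  by rewrite -derive_grad //; rewrite /derive E.
have he (t : R) : is_derive t (1 : R) e (e' t).
  pose f t := h (z + t *: d).
  have -> : e = sg *: (f - dot (grad h z) d *: id) - (l / 2 * dot d d) *: (id ^+ 2 : R -> R).
    apply/funext => u; rewrite /e !fctE /= /f.
    by rewrite /GRing.scale /=; ring.
  have hf : is_derive t (1 : R) f (dot (grad h (z + t *: d)) d) by exact: hline.
  apply: is_derive_eq; rewrite /e' /GRing.scale /=.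
  by field.
have ce : {within `[0, 1], continuous e}.
  apply: derivable_within_continuous => t _; exact: ex_derive.
have [t t01] := MVT_segment ler01 (fun t _ => he t) ce.
rewrite in_itv /= in t01; case/andP: t01 => t0 t1.
rewrite subr0 mulr1 /e /e' !scale0r !addr0 !scale1r mul0r !expr0n /= mulr0 mul0r !subr0 expr1n mulr1 mul1r.
have -> : z + d = z' by rewrite /d addrC subrK.
have : sg * (dot (grad h (z + t *: d)) d - dot (grad h z) d) <= l * t * dot d d.
  apply: le_trans (ler_norm _) _; rewrite normrM sg1 mul1r -dotNl -dotDl.
  apply: le_trans (norm_dot_le _ _) _; rewrite -enorm_sqr expr2 mulrA ler_wpM2r ?enorm_ge0 //.
  apply: le_trans (lh _ _) _.
  by rewrite addrC addKr enormZ (ger0_norm t0) mulrA.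
lra.
Qed.

Lemma smooth_quad_grad n (l : R) (h : 'rV[R]_n -> R) :
  smooth l h -> quad_grad setT h (grad h) (l / 2).
Proof.
move=> sh z z' _ _; rewrite ler_norml.
have := smooth_upper z z' sh (normr1 _).
have := smooth_upper z z' sh (_ : `|-1| = 1); rewrite normrN1 => /(_ erefl).
by move=> h1 h2; apply/andP; split; lra.
Qed.

(** A convex function lies above its tangents; the slope is recovered from
    the quadratic expansion by shrinking the segment. *)
Lemma convex_function_tangent n (h : 'rV[R]_n -> R) G K x x' :
  quad_grad setT h G K -> convex_function setT h ->
  h x + dot (G x) (x' - x) <= h x'.
Proof.
move=> hG hc; rewrite leNgt; apply/negP => neg.
set g := dot _ _ in neg; set q := dot (x' - x) (x' - x).
have q0 : 0 <= q by exact: dot_ge0.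
pose c := g - (h x' - h x); have c0 : 0 < c by rewrite /c; lra.
(* small enough for the quadratic remainder to be less than t c *)
pose t := c / (c + `|K| * q + 1).
have Kq : 0 <= `|K| * q by rewrite mulr_ge0.
have den : 0 < c + `|K| * q + 1 by lra.
have t0 : 0 < t by rewrite divr_gt0.
have t1 : t < 1 by rewrite ltr_pdivrMr //; lra.
have conv : h (x + t *: (x' - x)) <= t * h x' + (1 - t) * h x.
  have := hc (Itv01 (ltW t0) (ltW t1)) x' x (in_setT _) (in_setT _).
  rewrite /conv /=; have -> // : t *: x' + (1 - t) *: x = x + t *: (x' - x).
  by apply/rowP => i; rewrite !mxE; ring.
have := hG x (x + t *: (x' - x)) I I.
rewrite [x + _ - x]addrAC subrr add0r !dotZl !dotZr -/g -/q ler_norml => /andP[h1 _].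
have : t * c <= t * (t * (K * q)) by rewrite /c; lra.
rewrite ler_pM2l // => h2.
have h3 : t * (K * q) <= t * (`|K| * q).
  by rewrite ler_wpM2l ?(ltW t0) // ler_wpM2r // ler_norm.
have : t * (c + `|K| * q + 1) = c by rewrite divfK ?gt_eqF.
by nra.
Qed.

Lemma dot_row_mx m n (a c : 'rV[R]_m) (b d : 'rV[R]_n) :
  dot (row_mx a b) (row_mx c d) = dot a c + dot b d.
Proof.
rewrite /dot big_split_ord; congr (_ + _); apply: eq_bigr => i _.
  by rewrite !row_mxEl.
by rewrite !row_mxEr.
Qed.

Lemma dot_submx m n (z w : 'rV[R]_(m + n)) :
  dot z w = dot (lsubmx z) (lsubmx w) + dot (rsubmx z) (rsubmx w).
Proof. by rewrite -dot_row_mx !hsubmxK. Qed.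

Lemma sub_row_mx m n (a c : 'rV[R]_m) (b d : 'rV[R]_n) :
  row_mx a b - row_mx c d = row_mx (a - c) (b - d).
Proof. by rewrite opp_row_mx add_row_mx. Qed.

Lemma smooth_saddle_fun m n (f : 'rV[R]_m -> 'rV[R]_n -> R) (l : R)
    (X : set 'rV[R]_m) (Y : set 'rV[R]_n) : 0 < l -> smooth l (joint f) ->
  (forall y, Y y -> convex_function setT (fun x => f x y)) ->
  (forall x, X x -> convex_function setT (fun y => - f x y)) ->
  saddle_fun l 0 0 X Y f (fun x y => lsubmx (grad (joint f) (row_mx x y)))
    (fun x y => rsubmx (grad (joint f) (row_mx x y))).
Proof.
move=> l0 sf cx cy; have hq := smooth_quad_grad sf.
have expand x y x' y' : `|f x' y' - f x y
    - (dot (lsubmx (grad (joint f) (row_mx x y))) (x' - x)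
      + dot (rsubmx (grad (joint f) (row_mx x y))) (y' - y))|
    <= l / 2 * (dot (x' - x) (x' - x) + dot (y' - y) (y' - y)).
  have := hq (row_mx x y) (row_mx x' y') I I.
  by rewrite sub_row_mx dot_row_mx /joint dot_submx !row_mxKl !row_mxKr.
split.
- move=> x y x' y'; have := expand x y x' y'.
  by rewrite !ler_norml => /andP[h1 h2]; apply/andP; split; lra.
- move=> x x' y Yy; rewrite mul0r mul0r addr0.
  apply: (convex_function_tangent (K := l / 2)
    (G := fun x => lsubmx (grad (joint f) (row_mx x y)))) (cx y Yy).
  move=> z z' _ _; have := expand z y z' y.
  by rewrite subrr !dot0r !addr0.
- move=> x y y' Xx; rewrite mul0r mul0r subr0.
  have : - f x y + dot (- rsubmx (grad (joint f) (row_mx x y))) (y' - y) <= - f x y'.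
    apply: (convex_function_tangent (K := l / 2)
      (G := fun y => - rsubmx (grad (joint f) (row_mx x y)))) (cy x Xx).
    move=> z z' _ _; have := expand x z x z'.
    rewrite subrr !dot0r !add0r dotNl !ler_norml => /andP[h1 h2].
    by apply/andP; split; lra.
  by rewrite dotNl; lra.
- move=> x y x' y'; rewrite !scale0r subr0 addr0.
  have [_ lf] := sf; have := lf (row_mx x' y') (row_mx x y).
  rewrite enorm_le_sqr ?mulr_ge0 ?enorm_ge0 ?(ltW l0) //.
  rewrite exprMn enorm_sqr sub_row_mx dot_row_mx.
  by rewrite dot_submx !linearB.
Qed.

End smooth_convex.

Section convex_bodies.
Context {R : realType} {n : nat}.

Lemma convex_body (Z : set 'rV[R]_n) :
  Z !=set0 -> closed Z -> convex_set Z -> bounded_set Z -> body Z.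
Proof.
move=> Z0 cZ convZ bdZ; split=> //; first exact: bounded_closed_compact.
move=> x y t Zx Zy t0 t1.
have := convZ y x (Itv01 t0 t1) (mem_set Zy) (mem_set Zx); rewrite /conv /= => /set_mem.
have -> // : t *: y + (1 - t) *: x = x + t *: (y - x).
by apply/rowP => i; rewrite !mxE; ring.
Qed.

Lemma diam_le (Z : set 'rV[R]_n) D : is_diam Z D ->
  forall x y, Z x -> Z y -> enorm (x - y) <= D.
Proof. by move=> [_ ub] x y Zx Zy; apply: ub; exists x, y. Qed.

End convex_bodies.

(** * The regularized function *)

Section regularization.
Context {R : realType} {m n : nat}.
Context (f : 'rV[R]_m -> 'rV[R]_n -> R) (X : set 'rV[R]_m) (Y : set 'rV[R]_n).

Lemma f_reg_saddle_fun (l eps Dx Dy : R) fx fy x0 y0 :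
  saddle_fun l 0 0 X Y f fx fy ->
  exists Fx Fy, saddle_fun l (eps / (4 * Dx ^+ 2)) (eps / (4 * Dy ^+ 2)) X Y
    (f_reg f eps Dx Dy x0 y0) Fx Fy.
Proof.
move=> hf; have h1 := saddle_fun_prox (eps / (4 * Dx ^+ 2)) x0 hf.
have h2 := saddle_fun_prox (eps / (4 * Dy ^+ 2)) y0 (saddle_fun_swap h1).
have h3 := saddle_fun_swap h2; rewrite !add0r in h3.
eexists; eexists; have -> : f_reg f eps Dx Dy x0 y0 = (fun x y =>
    - (- (f x y + eps / (4 * Dx ^+ 2) / 2 * enorm (x - x0) ^+ 2)
       + eps / (4 * Dy ^+ 2) / 2 * enorm (y - y0) ^+ 2)).
  apply/funext => x; apply/funext => y; rewrite /f_reg opprD opprK.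
  have E D : eps / (4 * D ^+ 2) / 2 = eps / (8 * D ^+ 2).
    by rewrite -[LHS]mulrA -invfM mulrAC -natrM.
  by rewrite !E.
exact: h3.
Qed.

Lemma f_reg_gap_saddle (l eps Dx Dy : R) fx fy x0 y0 xo yo :
  0 < l -> 0 < eps -> 0 < Dx -> 0 < Dy -> saddle_fun l 0 0 X Y f fx fy ->
  body X -> body Y ->
  (forall x x', X x -> X x' -> enorm (x - x') <= Dx) ->
  (forall y y', Y y -> Y y' -> enorm (y - y') <= Dy) -> X x0 -> Y y0 ->
  X xo -> Y yo ->
  (forall x y, X x -> Y y -> f_reg f eps Dx Dy x0 y0 xo y
     - f_reg f eps Dx Dy x0 y0 x yo <= eps / 2) ->
  saddle X Y f eps xo yo.
Proof.
move=> l0 eps0 Dx0 Dy0 hf bX bY dX dY Xx0 Yy0 Xxo Yyo gap.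
have hx : quad_grad X (fun x => f x yo) (fun x => fx x yo) ((l + 0) / 2).
  by move=> x x' _ _; exact: (sf_grad_x l0 (lexx 0) hf).
have hy : quad_grad Y (fun y => - f xo y) (fun y => - fy xo y) ((l + 0) / 2).
  by move=> y y' _ _; exact: (sf_grad_x l0 (lexx 0) (saddle_fun_swap hf)).
have [x1 Xx1 min1] := quad_grad_argmin bX hx.
have [y1 Yy1 max1] := quad_grad_argmin bY hy.
split=> //; exists (f xo y1), (f x1 yo); split.
- by split; [exists y1 | move=> _ [y Yy <-]; rewrite -lerN2 max1].
- by split; [exists x1 | move=> _ [x Xx <-]; exact: min1].
have small D k (w : 'rV[R]_k) : 0 < D -> enorm w <= D ->
    eps / (8 * D ^+ 2) * enorm w ^+ 2 <= eps / 8.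
  move=> D0 wD; have -> : eps / 8 = eps / (8 * D ^+ 2) * D ^+ 2.
    by field; rewrite gt_eqF.
  rewrite ler_wpM2l ?divr_ge0 ?(ltW eps0) //; first by rewrite mulr_ge0 ?sqr_ge0.
  by rewrite ler_pXn2r ?nnegrE ?enorm_ge0 ?(ltW D0).
have pos D k (w : 'rV[R]_k) : 0 <= eps / (8 * D ^+ 2) * enorm w ^+ 2.
  by rewrite mulr_ge0 ?sqr_ge0 // divr_ge0 ?(ltW eps0) // mulr_ge0 ?sqr_ge0.
have := gap _ _ Xx1 Yy1; rewrite /f_reg.
have := small _ _ _ Dx0 (dX _ _ Xx1 Xx0).
have := small _ _ _ Dy0 (dY _ _ Yy1 Yy0).
have := pos Dx _ (xo - x0); have := pos Dy _ (yo - y0).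
move: (_ * enorm (x1 - x0) ^+ 2) (_ * enorm (y1 - y0) ^+ 2)
  (_ * enorm (xo - x0) ^+ 2) (_ * enorm (yo - y0) ^+ 2) => a b c d; lra.
Qed.

End regularization.

(** * Iteration counts *)

Section counting.
Context {R : realType}.

Lemma geometric_count (r M : R) : 0 < r -> r <= 1 -> 1 <= M ->
  exists t, [/\ (1 <= t)%N, (1 - r) ^+ t <= M^-1 & t%:R <= ln M / r + 1].
Proof.
move=> r0 r1 M1; have M0 : 0 < M by lra.
have x0 : 0 <= ln M / r by rewrite divr_ge0 ?ln_ge0 // ltW.
exists (Num.truncn (ln M / r)).+1; split=> //; last first.
  by rewrite -natr1 lerD2r truncn_le.
apply: (@le_trans _ _ (expR (- r) ^+ (Num.truncn (ln M / r)).+1)).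
  by rewrite ler_pXn2r ?nnegrE ?expR_ge0 ?subr_ge0 // expR_ge1Dx.
rewrite -expRM_natl -[M in leRHS](lnK (_ : M \is Num.pos)) ?posrE // -expRN ler_expR.
rewrite mulrN lerN2 -ler_pdivrMr //; exact/ltW/truncnS_gt.
Qed.

(** Everything that enters a logarithm is at most a power of S. *)
Definition pow_bounded (S x : R) (j : nat) : Prop := 0 <= x /\ x <= S ^+ j.

Lemma pow_boundedM S x y i j : pow_bounded S x i -> pow_bounded S y j ->
  pow_bounded S (x * y) (i + j).
Proof.
move=> [x0 xS] [y0 yS]; split; first exact: mulr_ge0.
by rewrite exprD; exact: ler_pM.
Qed.

Lemma pow_boundedX S x i k : 0 <= S -> pow_bounded S x i ->
  pow_bounded S (x ^+ k) (i * k).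
Proof.
move=> S0 [x0 xS]; split; first exact: exprn_ge0.
by rewrite exprM; apply: lerXn2r; rewrite ?nnegrE ?exprn_ge0.
Qed.

Lemma pow_boundedW S x i j : 1 <= S -> pow_bounded S x i -> (i <= j)%N -> x <= S ^+ j.
Proof. by move=> S1 [_ xS] ij; exact: le_trans xS (ler_weXn2l S1 ij). Qed.

(** The constants and exponents are those of the tolerances; S^50 leaves room. *)
Lemma accuracies_bounded (S k1 k2 : R) :
  100 * 50 <= S -> 0 <= k1 -> k1 <= 4 * S -> 0 <= k2 -> k2 <= 4 * S ->
  let K := 45 * k2 in
  [/\ 25 / 4 * k1 * ((10 * k1 * k2) ^+ 4 * K ^+ 7) <= S ^+ 50,
      16 * k2 * (10 * K ^+ 5 * (10 * k1 * k2) ^+ 4) <= S ^+ 50,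
      5 * k1 * (2 * 10 ^+ 4 * (k1 * k2) ^+ 2) <= S ^+ 50 &
      3 / 2 * k2 * (10 ^+ 2 * k1 * k2 * (64 * k2 ^+ 3)) <= S ^+ 50].
Proof.
move=> S_big k1_0 k1S k2_0 k2S K.
have pc (c : R) : 0 <= c -> c <= 100 -> pow_bounded S c 1.
  by move=> c0 cS; split=> //; rewrite expr1; lra.
have p4S k : 0 <= k -> k <= 4 * S -> pow_bounded S k 2.
  move=> h0 h4; split=> //; rewrite expr2; apply: le_trans h4 _.
  by rewrite ler_wpM2r; lra.
have S0 : 0 <= S by lra.
have S1 : 1 <= S by lra.
have pk1 := p4S _ k1_0 k1S; have pk2 := p4S _ k2_0 k2S.
have c254 : pow_bounded S (25 / 4) 1 by apply: pc; lra.
have c32 : pow_bounded S (3 / 2) 1 by apply: pc; lra.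
have cn j : (j <= 100)%N -> pow_bounded S j%:R 1.
  by move=> j100; apply: pc; rewrite ?ler0n // ler_nat.
have p10 := pow_boundedX 4 S0 (pow_boundedM (pow_boundedM (cn 10 isT) pk1) pk2).
have pK : pow_bounded S K (1 + 2) := pow_boundedM (cn 45 isT) pk2.
split.
- have pb := pow_boundedM (pow_boundedM c254 pk1) (pow_boundedM p10 (pow_boundedX 7 S0 pK)).
  exact: (@pow_boundedW _ _ _ 50 S1 pb isT).
- have pb := pow_boundedM (pow_boundedM (cn 16 isT) pk2)
    (pow_boundedM (pow_boundedM (cn 10 isT) (pow_boundedX 5 S0 pK)) p10).
  exact: (@pow_boundedW _ _ _ 50 S1 pb isT).
- have pb := pow_boundedM (pow_boundedM (cn 5 isT) pk1)
    (pow_boundedM (pow_boundedM (cn 2 isT) (pow_boundedX 4 S0 (cn 10 isT)))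
      (pow_boundedX 2 S0 (pow_boundedM pk1 pk2))).
  exact: (@pow_boundedW _ _ _ 50 S1 pb isT).
- have pb := pow_boundedM (pow_boundedM c32 pk2)
    (pow_boundedM (pow_boundedM (pow_boundedM (pow_boundedX 2 S0 (cn 10 isT)) pk1) pk2)
      (pow_boundedM (cn 64 isT) (pow_boundedX 3 S0 pk2))).
  exact: (@pow_boundedW _ _ _ 50 S1 pb isT).
Qed.

Lemma ln_ge1 (S : R) : 4 <= S -> 1 <= ln S.
Proof.
move=> S4; have h2 : 2^-1 <= ln (2 : R).
  have := expR_ge1Dx (- ln (2 : R)); rewrite expRN lnK ?posrE //; lra.
apply: (@le_trans _ _ (ln (2 ^+ 2))); last by rewrite ler_ln ?posrE //; lra.
by rewrite lnXn // mulr2n; lra.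
Qed.

(** Numbers of iterations for which all the accuracies prescribed by the
    procedures are reached. Every accuracy is, relatively to the initial error
    of its loop, at least S^-50, whence one logarithm per loop. *)
Lemma counts_exist (l s v ep Dx Dy S : R) :
  let k1 := l / s in let k2 := l / v in
  let tau := ep / (10 * k1 * k2) ^+ 4 in let K := 45 * k2 in
  let e := tau / K ^+ 7 / l in
  0 < l -> 0 < s -> 0 < v -> 0 < ep ->
  100 * 100 <= k1 -> 100 * 100 <= k2 -> k1 + k2 = 4 * S ->
  0 <= Dx -> 0 <= Dy -> l * Dx ^+ 2 = k1 * ep / 2 -> l * Dy ^+ 2 = k2 * ep / 2 ->
  exists t1 t2 t3 t4 : nat,
  [/\ (1 <= t1)%N, (9 / 10) ^+ t1 * (5 / 3 * Dx) <= Num.sqrt (2 / 9 * e),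
    (1 - (2 * Num.sqrt (72 * k2))^-1) ^+ t2 * (27 * l * Dy ^+ 2 + 2 * l ^+ 2 * e / v)
      <= tau / (10 * K ^+ 5),
    (1 - (2 * (2 * Num.sqrt k1))^-1) ^+ t3 * (6 * l * Dx ^+ 2 + 2 * k1 * tau)
      <= ep / (2 * 10 ^+ 4 * (k1 * k2) ^+ 2) &
    (1 - (2 * Num.sqrt k2)^-1) ^+ t4 * (3 * l * Dy ^+ 2)
      <= ep / (10 ^+ 2 * k1 * k2) / (64 * k2 ^+ 3)] /\
  [/\ t1%:R <= 500 * ln S + 1, t2%:R <= 900 * Num.sqrt k2 * ln S + 1,
    t3%:R <= 200 * Num.sqrt k1 * ln S + 1 & t4%:R <= 100 * Num.sqrt k2 * ln S + 1].
Proof.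
have nine0 : 0 <= 9 / 10 :> R by lra.
have nine1 : 9 / 10 <= 1 :> R by lra.
move=> k1 k2 tau K e l0 s0 v0 ep0 k1_big k2_big kS Dx0 Dy0 eDx eDy.
have k1_gt0 : 0 < k1 by lra.
have k2_gt0 : 0 < k2 by lra.
have S_big : 100 * 50 <= S by lra.
have S0 : 0 < S by lra.
have S1 : 1 <= S by lra.
pose M := S ^+ 50.
have M1 : 1 <= M by exact: exprn_ege1.
have M0 : 0 < M by lra.
have lnM : ln M = 50 * ln S by rewrite /M lnXn // mulr_natl.
have lnS : 1 <= ln S by apply: ln_ge1; lra.
have sq_ge1 k : 100 * 100 <= k -> 1 <= Num.sqrt k :> R.
  by move=> hk; rewrite -[leLHS]sqrtr1 ler_wsqrtr //; lra.
have k1_1 := sq_ge1 _ k1_big; have k2_1 := sq_ge1 _ k2_big.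
have sq72 : Num.sqrt (72 * k2) <= 9 * Num.sqrt k2.
  have -> : 9 = Num.sqrt (9 ^+ 2) :> R by rewrite sqrtr_sqr ger0_norm.
  by rewrite -sqrtrM ?sqr_ge0 // ler_wsqrtr //; lra.
have sq72_1 : 1 <= Num.sqrt (72 * k2) by apply: sq_ge1; lra.
have cnt Q : 1 <= Q -> exists t, [/\ (1 <= t)%N, (1 - Q^-1) ^+ t <= M^-1 &
    t%:R <= 50 * Q * ln S + 1].
  move=> Q1; have Q0 : 0 < Q^-1 by rewrite invr_gt0; lra.
  have Q1' : Q^-1 <= 1 by rewrite invf_le1 //; lra.
  have [t [h1 h2 h3]] := geometric_count Q0 Q1' M1.
  by exists t; split=> //; move: h3; rewrite invrK lnM mulrAC.
have k1_4S : k1 <= 4 * S by lra.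
have k2_4S : k2 <= 4 * S by lra.
have [B1 B2 B3 B4] := accuracies_bounded S_big (ltW k1_gt0) k1_4S (ltW k2_gt0) k2_4S.
rewrite -/K -/M in B1 B2 B3 B4.
have kk1 : 1 <= (10 * k1 * k2) ^+ 4.
  have k1_ge1 : 1 <= k1 by lra.
  have k2_ge1 : 1 <= k2 by lra.
  by apply: exprn_ege1; apply: mulr_ege1 => //; apply: mulr_ege1 => //; rewrite ler1n.
have kk0 : 0 < (10 * k1 * k2) ^+ 4 by lra.
have K1 : 1 <= K by rewrite /K; lra.
have K0 : 0 < K by lra.
have Kn j : 0 < K ^+ j by rewrite exprn_gt0.
have tau0 : 0 < tau by rewrite divr_gt0.
have tau_le : tau <= ep by rewrite ler_pdivrMr // ler_peMr // ltW.
have fin g A c P : g <= M^-1 -> 0 <= A -> A <= c * ep -> 0 < P -> c * P <= M -> g * A <= ep / P.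
  move=> gM A0 Ac P0 cP; apply: le_trans (ler_wpM2r A0 gM) _.
  rewrite ler_pdivlMr // -mulrA ler_pdivrMl //.
  apply: le_trans (ler_wpM2r (ltW P0) Ac) _.
  by rewrite mulrAC ler_wpM2r // ltW.
have [t1 [t1_1 g1 c1]] := cnt 10 ltac:(lra).
have [t2 [_ g2 c2]] := cnt (2 * Num.sqrt (72 * k2)) ltac:(lra).
have [t3 [_ g3 c3]] := cnt (2 * (2 * Num.sqrt k1)) ltac:(lra).
have [t4 [_ g4 c4]] := cnt (2 * Num.sqrt k2) ltac:(lra).
have tenth : 1 - 10^-1 = 9 / 10 :> R by field.
rewrite tenth in g1.
exists t1, t2, t3, t4; split; split=> //.
- have g0 : 0 <= (9 / 10 : R) ^+ t1 by exact: exprn_ge0 _ nine0.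
  have g1' : (9 / 10 : R) ^+ t1 <= 1 by exact: exprn_ile1.
  have gg : (9 / 10) ^+ t1 * (9 / 10) ^+ t1 <= M^-1.
    by apply: le_trans g1; rewrite ler_piMr.
  set g := _ ^+ t1 in g0 g1' gg *.
  have A0 : 0 <= g * (5 / 3 * Dx) by rewrite mulr_ge0 // mulr_ge0 //; lra.
  rewrite -[leLHS]ger0_norm // -sqrtr_sqr ler_wsqrtr // -(ler_pM2l l0).
  have P0 : 0 < (10 * k1 * k2) ^+ 4 * K ^+ 7 by rewrite mulr_gt0.
  have -> : l * (2 / 9 * e) = 2 / 9 * (ep / ((10 * k1 * k2) ^+ 4 * K ^+ 7)).
    by rewrite /e /tau; field; rewrite ?gt_eqF.
  have h : g * g * (25 / 4 * k1 * ep) <= ep / ((10 * k1 * k2) ^+ 4 * K ^+ 7).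
    apply: (fin _ _ (25 / 4 * k1)) => //.
    by rewrite mulr_ge0 ?(ltW ep0) // mulr_ge0 ?(ltW k1_gt0) //; lra.
  have -> : l * (g * (5 / 3 * Dx)) ^+ 2 = 25 / 9 * (g * g) * (l * Dx ^+ 2) by field.
  by rewrite eDx; lra.
- have -> : tau / (10 * K ^+ 5) = ep / (10 * K ^+ 5 * (10 * k1 * k2) ^+ 4).
    by rewrite /tau; field; rewrite ?gt_eqF.
  have eE : 2 * l ^+ 2 * e / v = 2 * k2 * (tau / K ^+ 7).
    by rewrite /e /k2; field; rewrite ?gt_eqF.
  have te : tau / K ^+ 7 <= ep.
    rewrite ler_pdivrMr //; apply: le_trans tau_le _; rewrite ler_peMr ?(ltW ep0) //.
    exact: exprn_ege1.
  have te0 : 0 <= tau / K ^+ 7 by rewrite divr_ge0 // ltW.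
  have k2ep := mulr_ge0 (ltW k2_gt0) (ltW ep0).
  apply: (fin _ _ (16 * k2)) => //.
  + rewrite eE; apply: addr_ge0; last exact: mulr_ge0 (mulr_ge0 (ler0n _ 2) (ltW k2_gt0)) te0.
    exact: mulr_ge0 (mulr_ge0 (ler0n _ 27) (ltW l0)) (sqr_ge0 Dy).
  + rewrite eE -mulrA eDy; have := ler_wpM2l (ltW k2_gt0) te; lra.
  + exact: mulr_gt0 (mulr_gt0 (ltr0Sn _ 9) (Kn 5)) kk0.
- have k1ep := mulr_ge0 (ltW k1_gt0) (ltW ep0).
  have kk2 : 0 < (k1 * k2) ^+ 2 by rewrite exprn_gt0 // mulr_gt0.
  have ten4 : 0 < 2 * 10 ^+ 4 :> R by rewrite mulr_gt0 // exprn_gt0.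
  apply: (fin _ _ (5 * k1)) => //.
  + apply: addr_ge0; last exact: mulr_ge0 (mulr_ge0 (ler0n _ 2) (ltW k1_gt0)) (ltW tau0).
    exact: mulr_ge0 (mulr_ge0 (ler0n _ 6) (ltW l0)) (sqr_ge0 Dx).
  + rewrite -mulrA eDx; have := ler_wpM2l (ltW k1_gt0) tau_le; lra.
  + exact: mulr_gt0 ten4 kk2.
- have -> : ep / (10 ^+ 2 * k1 * k2) / (64 * k2 ^+ 3) =
      ep / (10 ^+ 2 * k1 * k2 * (64 * k2 ^+ 3)) by rewrite -[LHS]mulrA -invfM.
  have k2ep := mulr_ge0 (ltW k2_gt0) (ltW ep0).
  apply: (fin _ _ (3 / 2 * k2)) => //.
  + exact: mulr_ge0 (mulr_ge0 (ler0n _ 3) (ltW l0)) (sqr_ge0 Dy).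
  + by rewrite -mulrA eDy; lra.
  + have hundred : 0 < 10 ^+ 2 :> R by rewrite exprn_gt0.
    have k23 : 0 < k2 ^+ 3 by rewrite exprn_gt0.
    exact: mulr_gt0 (mulr_gt0 (mulr_gt0 hundred k1_gt0) k2_gt0) (mulr_gt0 (ltr0Sn _ 63) k23).
- by move: c1; lra.
- by have := ler_wpM2r (le_trans ler01 lnS) sq72; move: c2; lra.
- lra.
- lra.
Qed.

End counting.

Lemma total_count (R : realType) (a b L : R) (t1 t2 t3 t4 N : nat) :
  1 <= a -> 1 <= b -> 1 <= L ->
  t1%:R <= 500 * L + 1 -> t2%:R <= 900 * b * L + 1 ->
  t3%:R <= 200 * a * L + 1 -> t4%:R <= 100 * b * L + 1 ->
  (N <= t3.+1 * (t2.+1 * (4 * t1 + 2) + 1) + 2 * t4.+1 + 1)%N ->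
  N%:R <= 1000 * 1000 * 1000 * (a * b * L ^+ 3).
Proof.
move=> a1 b1 L1 h1 h2 h3 h4 hN.
have bL : 1 <= b * L by exact: mulr_ege1.
have aL : 1 <= a * L by exact: mulr_ege1.
have i1 : (4 * t1 + 2)%N%:R <= 2006 * L :> R by rewrite natrD natrM; lra.
have i2 : t2.+1%:R <= 902 * (b * L) :> R by rewrite -natr1; lra.
have i3 : t3.+1%:R <= 202 * (a * L) :> R by rewrite -natr1; lra.
have i4 : t4.+1%:R <= 102 * (b * L) :> R by rewrite -natr1; lra.
have i5 : (t2.+1 * (4 * t1 + 2) + 1)%N%:R <= 1000 * 2007 * (b * L * L) :> R.
  rewrite natrD natrM; have := ler_pM (ler0n R _) (ler0n R _) i2 i1.
  have : 1 <= b * L * L by exact: mulr_ege1.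
  by lra.
have i6 := ler_pM (ler0n R _) (ler0n R _) i3 i5.
have bL0 : 0 <= b * L by lra.
have LL : 1 <= a * L * L by exact: mulr_ege1.
have i7 := ler_wpM2r bL0 LL; rewrite mul1r in i7.
have : N%:R <= (t3.+1 * (t2.+1 * (4 * t1 + 2) + 1) + 2 * t4.+1 + 1)%N%:R :> R by rewrite ler_nat.
have -> A B D : (A * B + 2 * D + 1)%N%:R = A%:R * B%:R + 2 * D%:R + 1 :> R.
  by rewrite natrD natrD natrM natrM.
by lra.
Qed.

Unset Implicit Arguments.

(* C and c are the absolute constants of O(.): the bound, and the procedures
   themselves, are only meaningful for eps small relative to l Dx^2, l Dy^2. *)
Theorem corollary5p3 (R : realType) :
  exists C c : R, [/\ 0 < C, 0 < c &
    forall (m n : nat) (f : 'rV[R]_m -> 'rV[R]_n -> R) (l : R)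
      (X : set 'rV[R]_m) (Y : set 'rV[R]_n) (Dx Dy : R)
      (x0 : 'rV[R]_m) (y0 : 'rV[R]_n) (eps : R),
      0 < l -> smooth l (joint f) ->
      X !=set0 -> closed X -> convex_set X -> bounded_set X ->
      Y !=set0 -> closed Y -> convex_set Y -> bounded_set Y ->
      (forall y, Y y -> convex_function setT (fun x => f x y)) ->
      (forall x, X x -> convex_function setT (fun y => - f x y)) ->
      is_diam X Dx -> is_diam Y Dy -> 0 < Dx -> 0 < Dy ->
      X x0 -> Y y0 -> 0 < eps ->
      eps <= c * (l * Dx ^+ 2) -> eps <= c * (l * Dy ^+ 2) ->
      exists T : nat, (0 < T)%N /\
      exists (xh : 'rV[R]_m) (yh : 'rV[R]_n) (N : nat),
        [/\ Minimax_APPA X Y (f_reg f eps Dx Dy x0 y0) x0 y0 l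
              (eps / (4 * Dx ^+ 2)) (eps / (4 * Dy ^+ 2)) (eps / 2) T xh yh N,
            saddle X Y f eps xh yh &
            N%:R <= C * (l * Dx * Dy / eps *
                         ln (l * (Dx ^+ 2 + Dy ^+ 2) / eps) ^+ 3)]].
Proof.
(* with c = 1 / 2500 both condition numbers are at least 10000 *)
exists (4 * (1000 * 1000 * 1000)), (50 * 50)^-1; split.
- by lra.
- by rewrite invr_gt0; lra.
move=> m n f l X Y Dx Dy x0 y0 eps l0 sf X0 cX convX bdX Y0 cY convY bdY cvx ccv.
move=> diamX diamY Dx0 Dy0 Xx0 Yy0 eps0 epsx epsy.
have bX := convex_body X0 cX convX bdX; have bY := convex_body Y0 cY convY bdY.
have dX := diam_le diamX; have dY := diam_le diamY.
have hf := smooth_saddle_fun l0 sf cvx ccv.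
have [Fx [Fy hF]] := f_reg_saddle_fun eps Dx Dy x0 y0 hf.
have Dx2 : 0 < Dx ^+ 2 by rewrite exprn_gt0.
have Dy2 : 0 < Dy ^+ 2 by rewrite exprn_gt0.
set mu1 := eps / (4 * Dx ^+ 2) in hF *; set mu2 := eps / (4 * Dy ^+ 2) in hF *.
have mu1_gt0 : 0 < mu1 by rewrite divr_gt0 // mulr_gt0.
have mu2_gt0 : 0 < mu2 by rewrite divr_gt0 // mulr_gt0.
have sl : 100 * (100 * mu1) <= l.
  by rewrite /mu1 !mulrA ler_pdivrMr ?mulr_gt0 //; move: epsx; rewrite ler_pdivlMl ?mulr_gt0 //; lra.
have vl : 100 * (100 * mu2) <= l.
  by rewrite /mu2 !mulrA ler_pdivrMr ?mulr_gt0 //; move: epsy; rewrite ler_pdivlMl ?mulr_gt0 //; lra.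
have k1_big : 100 * 100 <= l / mu1 by rewrite ler_pdivlMr //; lra.
have k2_big : 100 * 100 <= l / mu2 by rewrite ler_pdivlMr //; lra.
have ep0 : 0 < eps / 2 by lra.
set S := l * (Dx ^+ 2 + Dy ^+ 2) / eps.
have kS : l / mu1 + l / mu2 = 4 * S by rewrite /mu1 /mu2 /S; field; rewrite ?gt_eqF.
have eDx : l * Dx ^+ 2 = l / mu1 * (eps / 2) / 2 by rewrite /mu1; field; rewrite ?gt_eqF.
have eDy : l * Dy ^+ 2 = l / mu2 * (eps / 2) / 2 by rewrite /mu2; field; rewrite ?gt_eqF.
have [t1 [t2 [t3 [t4 [[t1_gt0 c1 c2 c3 c4] [n1 n2 n3 n4]]]]]] :=
  counts_exist l0 mu1_gt0 mu2_gt0 ep0 k1_big k2_big kS (ltW Dx0) (ltW Dy0) eDx eDy.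
have [xh [yh [N [hA Xxh Yyh gap hN]]]] := Minimax_APPA_exists l0 mu1_gt0 sl mu2_gt0 vl
  ep0 hF bX bY dX dY Xx0 Yy0 t1_gt0 c1 c2 c3 c4.
exists t3.+1; split=> //; exists xh, yh, N; split=> //.
  exact: f_reg_gap_saddle l0 eps0 Dx0 Dy0 hf bX bY dX dY Xx0 Yy0 Xxh Yyh gap.
have sq_ge1 k : 100 * 100 <= k -> 1 <= Num.sqrt k :> R.
  by move=> hk; rewrite -[leLHS]sqrtr1 ler_wsqrtr //; lra.
have lnS : 1 <= ln S by apply: ln_ge1; lra.
have := total_count (sq_ge1 _ k1_big) (sq_ge1 _ k2_big) lnS n1 n2 n3 n4 hN.
have k1_ge0 : 0 <= l / mu1 by lra.
have -> : Num.sqrt (l / mu1) * Num.sqrt (l / mu2) = 4 * (l * Dx * Dy / eps).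
  rewrite -sqrtrM //; have -> : l / mu1 * (l / mu2) = (4 * (l * Dx * Dy / eps)) ^+ 2.
    by rewrite /mu1 /mu2; field; rewrite ?gt_eqF.
  by rewrite sqrtr_sqr ger0_norm // mulr_ge0 // divr_ge0 ?(ltW eps0) // !mulr_ge0 // ltW.
move: (1000 * 1000 * 1000) (l * Dx * Dy / eps) (ln S ^+ 3) => C p q h.
by apply: le_trans h _; rewrite le_eqVlt; apply/orP; left; apply/eqP; ring.
Qed.
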